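(* Let $p>5$ be a prime and $\mathbf{F}$ a field of characteristic $p$. Choose a basis $\{X_1,X_2,X_3,X_4,X_5\}$ of $V_5^*$ with $\Delta(X_i)=X_{i-1}$ for $i>1$ and $\Delta(X_1)=0$, and use the graded reverse lexicographic order with $X_1<X_2<X_3<X_4<X_5$. Then a reduced Gröbner basis for the Hilbert ideal of $V_5$ is given by $$\{X_1,\ X_2^2,\ X_3^2-2X_4X_2-X_3X_2,\ X_4X_3X_2,\ X_4^{p-4}X_2,\ X_4^{p-3}X_3,\ X_4^{p-1},\ X_5^p\};$$ the corresponding monomial basis for $\mathbf{F}[V_5]_{\mathbf{Z}/p}$ is given by the monomial factors (divisors) of $x_4^{p-2}x_5^{p-1}$, $x_3x_4^{p-4}x_5^{p-1}$, $x_2x_4^{p-5}x_5^{p-1}$ and $x_2x_3x_5^{p-1}$; and the Hilbert series of $\mathbf{F}[V_5]_{\mathbf{Z}/p}$ is $(1 + 3t+4t^2+3(t^3+ \cdots +t^{p-4})+2t^{p-3}+t^{p-2})(1+t+\cdots +t^{p-1})$.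
   Context: For $n\le p$, $V_n$ is the $n$-dimensional indecomposable representation over $\mathbf{F}$ of the cyclic group $\mathbf{Z}/p=\langle\sigma\rangle$ on which $\sigma$ acts by a single Jordan block with eigenvalue $1$. The action on $V_n^*$ extends to algebra automorphisms of $\mathbf{F}[V_n]=S(V_n^* )$; $\Delta:=\sigma-1$. The Hilbert ideal is the ideal of $\mathbf{F}[V_n]$ generated by all homogeneous invariants of positive degree, and the ring of coinvariants $\mathbf{F}[V_n]_{\mathbf{Z}/p}$ is the quotient of $\mathbf{F}[V_n]$ by the Hilbert ideal, with its induced grading. Lower case letters denote images in the coinvariants of the variables written in upper case. The monomial basis corresponding to a Gröbner basis consists of the images of the monomials not divisible by any leading monomial of the Gröbner basis. *)

(* Defs.v *)
From HB Require Import structures.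
From mathcomp Require Import all_boot all_order all_algebra.
From mathcomp Require Import ring_quotient mpoly.
From mathcomp Require boolp.

Set Implicit Arguments.
Unset Strict Implicit.
Unset Printing Implicit Defensive.

Import GRing.Theory.
Local Open Scope ring_scope.
Local Open Scope quotient_scope.

(* Variables are numbered from 0: 'X_i, with i : 'I_n, is X_{i+1} in the usual numbering. *)

Section GradedReverseLexicographic.
Variable n : nat.
Implicit Types m : 'X_{1..n}.

(* For the variable ordering X_1 < ... < X_n: between two monomials of the same
   degree, the smaller one has the larger exponent at the smallest variable
   where the exponents differ. *)
Definition grevlex_lt m1 m2 : bool :=
  (mdeg m1 < mdeg m2)%N ||
  (mdeg m1 == mdeg m2) &&
    [exists i : 'I_n, (m2 i < m1 i)%N &&
       [forall j : 'I_n, (j < i)%N ==> (m1 j == m2 j)]].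

Definition grevlex_max m1 m2 := if grevlex_lt m1 m2 then m2 else m1.

(* [mlead] is not suitable here: it refers to another monomial order.  The
   unit monomial is the least element of the order; it is also the (junk)
   value of [glead] at the zero polynomial. *)
Definition glead (R : nzRingType) (f : {mpoly R[n]}) : 'X_{1..n} :=
  \big[grevlex_max/0%MM]_(m <- msupp f) m.

End GradedReverseLexicographic.

Definition is_groebner (F : fieldType) n (I : {mpoly F[n]} -> Prop)
    (G : seq {mpoly F[n]}) : Prop :=
  (forall g, g \in G -> g != 0 /\ I g) /\
  (forall f, I f -> f != 0 -> exists2 g, g \in G & (glead g <= glead f)%MM).

Definition is_reduced_groebner (F : fieldType) n (I : {mpoly F[n]} -> Prop)
    (G : seq {mpoly F[n]}) : Prop :=
  [/\ is_groebner I G,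
      forall g, g \in G -> g@_(glead g) = 1
    & forall g h m, g \in G -> h \in G -> h != g -> m \in msupp g ->
        ~~ (glead h <= m)%MM].

Definition standard_monomial (F : fieldType) n (G : seq {mpoly F[n]}) :
    pred 'X_{1..n} :=
  fun m => ~~ has (fun g => (glead g <= m)%MM) G.

Section LinearAlgebra.
Variables (F : fieldType) (V : lmodType F).

(* [basis_of_family P v W]: the family (v i), for i satisfying P, is a basis of
   the subspace W of V; V need not be finite dimensional. *)
Definition basis_of_family (I : eqType) (P : pred I) (v : I -> V)
    (W : V -> Prop) : Prop :=
  [/\ forall i, P i -> W (v i),
      forall (s : seq I) (c : I -> F), uniq s -> all P s ->
        \sum_(i <- s) c i *: v i = 0 -> forall i, i \in s -> c i = 0
    & forall w, W w -> exists (s : seq I) (c : I -> F),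
        all P s /\ w = \sum_(i <- s) c i *: v i].

Definition has_dim (W : V -> Prop) (d : nat) : Prop :=
  exists v : 'I_d -> V, basis_of_family predT v W.

End LinearAlgebra.

Definition ideal_generated (R : comNzRingType) (S : R -> Prop) (f : R) : Prop :=
  exists s : seq (R * R),
    (forall q, q \in s -> S q.2) /\ f = \sum_(q <- s) q.1 * q.2.

Section Coinvariants.
Variables (F : fieldType) (n : nat).
Local Notation P := {mpoly F[n]}.

(* F[V_n] is the polynomial ring on a basis of V_n^* in which Delta is given by
   Delta X_1 = 0 and Delta X_i = X_{i-1} for i > 1 (the sum has at most one
   term); sigma = 1 + Delta on V_n^*, extended to an algebra endomorphism. *)
Definition Delta_var (i : 'I_n) : P := \sum_(j < n | j.+1 == i :> nat) 'X_j.

Definition sigma (f : P) : P := f \mPo [tuple 'X_i + Delta_var i | i < n].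

Definition invariant (f : P) : Prop := forall k : nat, iter k sigma f = f.

Definition homogeneous_invariant_pos (f : P) : Prop :=
  invariant f /\ exists2 d : nat, (0 < d)%N & f \is d.-homog.

Definition hilbert_ideal : P -> Prop :=
  ideal_generated homogeneous_invariant_pos.

Definition hilbert_ideal_pred : pred P := fun f => boolp.asbool (hilbert_ideal f).

Lemma hilbert_ideal_predP f : reflect (hilbert_ideal f) (f \in hilbert_ideal_pred).
Proof. exact: boolp.asboolP. Qed.

Lemma hilbert_ideal_closed : idealr_closed hilbert_ideal_pred.
Proof.
split.
- by apply/hilbert_ideal_predP; exists [::]; rewrite big_nil.
- apply/negP => /hilbert_ideal_predP[s [Ss]].
  move/(congr1 (mcoeff 0%MM)); rewrite mcoeff1 eqxx raddf_sum /= big_seq big1.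
    by move/eqP; rewrite oner_eq0.
  move=> q /Ss[_ [d d_gt0 q_homog]]; rewrite rmorphM /=.
  by rewrite (dhomog_nemf_coeff q_homog) ?mulr0 //= mdeg0 neq_ltn d_gt0.
- move=> a f g /hilbert_ideal_predP[s [Ss ->]] /hilbert_ideal_predP[t [St ->]].
  apply/hilbert_ideal_predP; exists ([seq (a * q.1, q.2) | q <- s] ++ t); split.
    move=> q; rewrite mem_cat => /orP[/mapP[r rs ->]|/St//]; exact: (Ss _ rs).
  rewrite big_cat big_map mulr_sumr /=; congr (_ + _).
  by apply: eq_bigr => q _; rewrite mulrA.
Qed.

HB.instance Definition _ := isIdealr.Build P hilbert_ideal_pred hilbert_ideal_closed.

Definition hilbert_idealr : idealr P := hilbert_ideal_pred.

Definition coinvariants : Type := {ideal_quot hilbert_idealr}.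

HB.instance Definition _ := GRing.ComNzRing.on coinvariants.

Definition to_coinvariants (f : P) : coinvariants :=
  \pi_({ideal_quot hilbert_idealr}) f.

Lemma to_coinvariants_is_zmod_morphism : zmod_morphism to_coinvariants.
Proof. exact: (rmorphB (\pi_({ideal_quot hilbert_idealr}))). Qed.

Lemma to_coinvariants_is_monoid_morphism : monoid_morphism to_coinvariants.
Proof.
split; first exact: (rmorph1 (\pi_({ideal_quot hilbert_idealr}))).
exact: (rmorphM (\pi_({ideal_quot hilbert_idealr}))).
Qed.

HB.instance Definition _ :=
  GRing.isZmodMorphism.Build P coinvariants to_coinvariants
    to_coinvariants_is_zmod_morphism.
HB.instance Definition _ :=
  GRing.isMonoidMorphism.Build P coinvariants to_coinvariants
    to_coinvariants_is_monoid_morphism.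

Definition coinvariants_scale (c : F) (x : coinvariants) : coinvariants :=
  to_coinvariants c%:MP * x.

Lemma coinvariants_scaleA a b x :
  coinvariants_scale a (coinvariants_scale b x) = coinvariants_scale (a * b) x.
Proof. by rewrite /coinvariants_scale mulrA -rmorphM -mpolyCM. Qed.

Lemma coinvariants_scale1 : left_id 1 coinvariants_scale.
Proof. by move=> x; rewrite /coinvariants_scale mpolyC1 rmorph1 mul1r. Qed.

Lemma coinvariants_scaleDr : right_distributive coinvariants_scale +%R.
Proof. by move=> a x y; rewrite /coinvariants_scale mulrDr. Qed.

Lemma coinvariants_scaleDl x : {morph coinvariants_scale^~ x : a b / a + b}.
Proof. by move=> a b; rewrite /coinvariants_scale mpolyCD rmorphD mulrDl. Qed.

HB.instance Definition _ :=
  GRing.Zmodule_isLmodule.Build F coinvariants coinvariants_scaleA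
    coinvariants_scale1 coinvariants_scaleDr coinvariants_scaleDl.

(* The homogeneous component of degree d for the induced grading. *)
Definition coinvariants_homog (d : nat) (x : coinvariants) : Prop :=
  exists2 f : P, f \is d.-homog & x = to_coinvariants f.

(* The coefficients of the Hilbert series of the coinvariants are those of h;
   only the case of a polynomial series is needed. *)
Definition coinvariants_hilbert_series (h : {poly nat}) : Prop :=
  forall d : nat, has_dim (coinvariants_homog d) (h`_d)%R.

(* The images of the monomials with exponent in B form an F-basis of the
   coinvariants; in particular they are pairwise distinct. *)
Definition is_monomial_basis (B : pred 'X_{1..n}) : Prop :=
  basis_of_family B (fun m => to_coinvariants 'X_[m]) (fun=> True).

End Coinvariants.

(* Main.v *)
Require Import Defs.
From HB Require Import structures.
From mathcomp Require Import all_boot all_order all_algebra.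
From mathcomp Require Import ring_quotient mpoly ssrcomplements bigenough ring zify.

(** The first four generators come from explicit invariants of degree at most 3,
    the next three from the transfers of X_5^(p-3), X_5^(p-2) and X_5^(p-1), which
    are computed with power sums over the prime field, and X_5^p from the monic
    polynomial whose roots are the conjugates of X_5.

    Conversely, let tau be the transpose of sigma for the apolar pairing between
    F[X_1, ..., X_5] and a second polynomial ring.  The image of tau - 1 pairs to
    zero with every invariant.  An induction on a grading by coweight shows that
    this image contains, for every monomial other than 1 that is divisible by none
    of the leading monomials, an element in which it occurs together with larger
    monomials only.  The polynomials killed by the resulting functionals and by the
    evaluation at 0 form an ideal, which contains the Hilbert ideal, and no nonzero
    polynomial with a standard leading monomial is killed by all of them. *)

Set Implicit Arguments.
Unset Strict Implicit.
Unset Printing Implicit Defensive.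

Import GRing.Theory BigEnough.
Local Open Scope ring_scope.

(** * The image of tau - 1 *)

Section CharacteristicP.
Variables (R : comNzRingType) (p : nat).
Hypothesis charR : p \in [pchar R].

(** On the dual variables [a, x, y, z, v] the map tau has the shape that sigma has on X_1, ..., X_5,
    so the quadratic invariants have the same formulas on both sides. The leading part of tau - 1
    lowers the coweight by one: relations of coweight k come from elements of coweight k + 1, and
    solving them divides only by positive integers up to k + 1. Hence the bound k + 1 < p. As [x^i],
    [y x^i], [z x^i] have coweights i, i + 2, i + 3, this bound is the source of the exponents p -
    1, p - 3 and p - 4.

    The obstacle is that the values of tau - 1 give too few relations among monomials with few
    factors [a]. The missing ones are products of a tau-fixed quadric with an image element of lower
    coweight. Such a product is lost when the cofactor is 1, or is [z x] or [y^2]: the last two pair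
    nontrivially with the invariant X_3^2 - 2 X_2 X_4 + ..., and only their sum lies in the image.
    This causes the special cases of low coweight.

    On the side of the relations, the transfer of X_5^(p-3) yields X_4^(p-4) X_2 with coefficient
    -5/2, which must be invertible. *)

Lemma natr_inv_pchar k : (0 < k < p)%N -> exists m, m%:R * k%:R = 1 :> R.
Proof.
move=> /andP[k_gt0 ltkp]; have p_pr := pcharf_prime charR.
have cop : coprime k p by rewrite coprime_sym prime_coprime // gtnNdvd.
have [u v Duv _] := egcdnP p k_gt0.
exists u; rewrite -natrM Duv (eqP cop) natrD natrM (pcharf0 charR) mulr0 add0r.
by [].
Qed.

End CharacteristicP.

Section ImageOfDifference.
Variables (R : comNzRingType) (tau : {rmorphism R -> R}).

Definition difference_image (r : R) : Prop := exists u, tau u = u + r.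

Lemma difference_image0 : difference_image 0.
Proof. by exists 0; rewrite rmorph0 addr0. Qed.

Lemma difference_imageD r s :
  difference_image r -> difference_image s -> difference_image (r + s).
Proof. by move=> [u hu] [w hw]; exists (u + w); rewrite rmorphD hu hw /=; ring. Qed.

(** The image of tau - 1 is a module over the subring fixed by tau. This is how invariant quadrics
    turn known image elements into new ones. *)
Lemma difference_image_fixedM r s :
  tau r = r -> difference_image s -> difference_image (r * s).
Proof. by move=> hr [u hu]; exists (r * u); rewrite rmorphM hr hu /=; ring. Qed.

Lemma difference_image_natM n r : difference_image r -> difference_image (n%:R * r).
Proof. by apply: difference_image_fixedM; rewrite rmorph_nat. Qed.

Lemma difference_imageN r : difference_image r -> difference_image (- r).
Proof. by rewrite -mulN1r; apply: difference_image_fixedM; rewrite rmorphN1. Qed.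

Lemma difference_imageB r s :
  difference_image r -> difference_image s -> difference_image (r - s).
Proof. by move=> hr /difference_imageN; apply: difference_imageD. Qed.

Lemma difference_imageDl r s :
  difference_image s -> difference_image (r + s) -> difference_image r.
Proof. by move=> /difference_imageN h /difference_imageD/(_ h); rewrite addrK. Qed.

Lemma difference_imageDr r s :
  difference_image r -> difference_image (r + s) -> difference_image s.
Proof. by move=> hr; rewrite addrC; apply: difference_imageDl. Qed.

Lemma eq_difference_image r s : difference_image r -> r = s -> difference_image s.
Proof. by move=> hr <-. Qed.

Lemma difference_image_sum I (s : seq I) (P : pred I) (f : I -> R) :
  (forall i, P i -> difference_image (f i)) ->
  difference_image (\sum_(i <- s | P i) f i).
Proof.
by apply: big_ind; [exact: difference_image0 | exact: difference_imageD].
Qed.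

Variable p : nat.
Hypothesis charR : p \in [pchar R].

Lemma difference_image_natM_cancel k r :
  (0 < k < p)%N -> difference_image (k%:R * r) -> difference_image r.
Proof.
move=> hk /(difference_image_natM).
by have [m mk] := natr_inv_pchar charR hk => /(_ m); rewrite mulrA mk mul1r.
Qed.

End ImageOfDifference.

(** The terms of order at least two in [a]; the sum is empty for [n <= 1]. Each factor [a] takes the
    place of a factor [x], so in the induction these terms have lower coweight than the linear
    one. *)
Definition binomial_tail (R : comNzRingType) (x a : R) n : R :=
  \sum_(l < n.-1) ('C(n, l) %:R * (x ^+ l * a ^+ (n - l))).

Lemma exprD_tail (R : comNzRingType) (x a : R) n :
  (x + a) ^+ n = x ^+ n + n%:R * (x ^+ n.-1 * a) + binomial_tail x a n.
Proof.
rewrite addrC exprDn /binomial_tail; case: n => [|n].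
  by rewrite big_ord1 big_ord0 subnn bin0; ring.
rewrite !big_ord_recr /= subnn subSnn binn binSn.
under eq_bigr => l _ do rewrite -mulr_natl [_ * x ^+ _]mulrC.
by rewrite -mulr_natl expr1 expr0 mul1r mulr1n; ring.
Qed.

Lemma binomial_tail_image (R : comNzRingType) (tau : {rmorphism R -> R})
    (x a w : R) n :
  (forall l, (l.+2 <= n)%N -> difference_image tau (w * (x ^+ l * a ^+ (n - l)))) ->
  difference_image tau (w * binomial_tail x a n).
Proof.
move=> hw; rewrite mulr_sumr; apply: difference_image_sum => l _.
rewrite mulrCA; apply: difference_image_natM; apply: hw.
by have := ltn_ord l; lia.
Qed.

(* Writing a, x, y, z, v for the dual basis vectors of X_5, ..., X_1, the
   monomials below are those that pair nontrivially with the monomial basis of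
   the coinvariants. *)
Section DualMonomials.
Variables (R : comNzRingType) (tau : {rmorphism R -> R}) (p : nat).
Hypothesis charR : p \in [pchar R].
Variables a x y z v : R.
Hypotheses (tau_a : tau a = a) (tau_x : tau x = x + a) (tau_y : tau y = y + x)
  (tau_z : tau z = z + y) (tau_v : tau v = v + z).

Local Notation I := (difference_image tau).

Lemma difference_expr w w' n j : tau w = w + w' ->
  (forall l e, (l < n)%N -> (j.+2 <= e)%N -> I ((w + w') * (x ^+ l * a ^+ e))) ->
  I (w' * (x ^+ n.+1 * a ^+ j) + n.+1%:R * ((w + w') * (x ^+ n * a ^+ j.+1))).
Proof.
move=> tau_w tail.
apply: (@difference_imageDl _ _ _ ((w + w') * a ^+ j * binomial_tail x a n.+1)).
  apply: binomial_tail_image => l lt_ln; rewrite -mulrA [a ^+ j * _]mulrCA -exprD.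
  by apply: tail; lia.
exists (w * (x ^+ n.+1 * a ^+ j)).
by rewrite !rmorphM !rmorphXn tau_w tau_x tau_a exprD_tail /= !exprS; ring.
Qed.

(** Under [a, x, y, z, v] -> X_1, ..., X_5, this quadric and the next one become the invariants that
    yield the relations for X_2^2 and X_3^2 in the coinvariants. *)
Lemma tau_q2 : tau (x ^+ 2 - 2%:R * y * a - x * a) = x ^+ 2 - 2%:R * y * a - x * a.
Proof.
by rewrite !rmorphB !rmorphM rmorph_nat tau_x tau_y tau_a /=; ring.
Qed.

Lemma tau_i2 (i2 := y ^+ 2 - 2%:R * z * x + 2%:R * v * a - y * x
    + 3%:R * z * a + y * a) : tau i2 = i2.
Proof.
rewrite /i2 !(rmorphB, rmorphD) !rmorphM !rmorph_nat.
by rewrite tau_x tau_y tau_a tau_z tau_v /=; ring.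
Qed.

(** Some side conditions here are forced: 1 pairs nontrivially with the invariant 1, and each of
    [y^2], [z x] and [v a] pairs nontrivially with the quadratic invariant X_3^2 - 2 X_2 X_4 + 2 X_1
    X_5 + .... *)
Definition pure_image k j := (0 < k + j)%N -> I (x ^+ k * a ^+ j).
Definition y_image k j := I (y * (x ^+ k * a ^+ j)).
Definition yy_image k j := (0 < k + j)%N -> I (y ^+ 2 * (x ^+ k * a ^+ j)).
Definition z_image k j := (k != 1) || (0 < j)%N -> I (z * (x ^+ k * a ^+ j)).
Definition yz_image k j := (1 < j)%N -> I (y * z * (x ^+ k * a ^+ j)).
Definition v_image k j := (1 < j)%N -> I (v * (x ^+ k * a ^+ j)).

(* The coweights of a, x, y, z, v are 0, ..., 4. *)
Definition coweight_image k : Prop :=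
  [/\ forall j, pure_image k j,
      forall i j, (i + 2 = k)%N -> y_image i j,
      forall i j, (i + 4 = k)%N -> yy_image i j
    & forall i j, (i + 3 = k)%N -> z_image i j] /\
  [/\ forall i j, (i + 5 = k)%N -> yz_image i j,
      forall i j, (i + 4 = k)%N -> v_image i j
    & k = 4 -> I (y ^+ 2 + z * x)].

Section InductionStep.
Variable k : nat.
Hypotheses (lt_k : (k.+1 < p)%N)
  (IH : forall k', (k' < k)%N -> coweight_image k').

Let cancel m r : (0 < m <= k.+1)%N -> I (m%:R * r) -> I r.
Proof. by move=> hm; apply: (difference_image_natM_cancel charR); lia. Qed.

Let lower_x i j : (i < k)%N -> pure_image i j.
Proof. by move=> /IH[[h _ _ _] _]; exact: (h j). Qed.
Let lower_y i j : (i + 2 < k)%N -> y_image i j.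
Proof. by move=> /IH[[_ h _ _] _]; exact: h. Qed.
Let lower_yy i j : (i + 4 < k)%N -> yy_image i j.
Proof. by move=> /IH[[_ _ h _] _]; exact: h. Qed.
Let lower_z i j : (i + 3 < k)%N -> z_image i j.
Proof. by move=> /IH[[_ _ _ h] _]; exact: h. Qed.
Let lower_yz i j : (i + 5 < k)%N -> yz_image i j.
Proof. by move=> /IH[_ [h _ _]]; exact: h. Qed.
Let lower_v i j : (i + 4 < k)%N -> v_image i j.
Proof. by move=> /IH[_ [_ h _]]; exact: h. Qed.

(** Modulo lower coweight, tau - 1 sends [x^(k+1) a^j] to [(k+1) x^k a^(j+1)]; here k + 1 has to be
    invertible. *)
Let xS_image j : I (x ^+ k * a ^+ j.+1).
Proof.
apply: (@cancel k.+1); first lia.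
have /(_ _ _)/eq_difference_image := @difference_expr 1 0 k j.
apply; last by ring.
  by rewrite rmorph1 addr0.
by move=> l e hl he; rewrite addr0 mul1r; apply: lower_x; lia.
Qed.

(* Here and below [difference_w] is the value of tau - 1 at w x^(n+1) a^j, modulo
   elements of lower coweight. *)
Let difference_y n j : (n.+2 = k)%N ->
  I (x ^+ n.+2 * a ^+ j + n.+1%:R * (y * (x ^+ n * a ^+ j.+1))).
Proof.
move=> hk.
have h := @difference_expr y x n j tau_y.
apply: (@difference_imageDl _ _ _ (n.+1%:R * (x ^+ n.+1 * a ^+ j.+1))).
  by apply: difference_image_natM; apply: lower_x; lia.
have -> : x ^+ n.+2 * a ^+ j + n.+1%:R * (y * (x ^+ n * a ^+ j.+1))
     + n.+1%:R * (x ^+ n.+1 * a ^+ j.+1)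
  = x * (x ^+ n.+1 * a ^+ j) + n.+1%:R * ((y + x) * (x ^+ n * a ^+ j.+1)).
  by rewrite !exprS; ring.
apply: h => l e hl he; rewrite mulrDl; apply: difference_imageD.
  by apply: lower_y; lia.
by rewrite mulrA -exprS; apply: lower_x; lia.
Qed.

(** Two relations hold modulo lower coweight: [x^k + (k-1) y x^(k-2) a], the value at [y x^(k-1)],
    and [x^k - 2 y x^(k-2) a], the fixed quadric times [x^(k-2)]. Their difference is (k + 1) times
    the second monomial. *)
Let x0_y1 : (1 < k)%N -> I (x ^+ k) /\ I (y * (x ^+ (k - 2) * a)).
Proof.
move=> k_gt1; have [n Dk] : exists n, k = n.+2 by exists (k - 2)%N; lia.
rewrite Dk -addn2 addnK addn2.
have := @difference_y n 0 (esym Dk); rewrite mulr1 expr1 => h.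
case: n Dk h => [|n] Dk h.
  (* For k = 2 the cofactor of the fixed quadric would be 1, which is not in the image. *)
  have hy : I (y * (x ^+ 0 * a)).
    by exists (z * a); rewrite rmorphM tau_z tau_a /= expr0; ring.
  split=> //; apply: difference_imageDl (h).
  exact: difference_image_natM hy.
have q : I (x ^+ n.+3 - 2%:R * (y * (x ^+ n.+1 * a))).
  apply: (@difference_imageDl _ _ _ (- (x ^+ n.+2 * a))).
    apply: difference_imageN; rewrite -[a]expr1; apply: lower_x; lia.
  have -> : x ^+ n.+3 - 2%:R * (y * (x ^+ n.+1 * a)) - x ^+ n.+2 * a
    = (x ^+ 2 - 2%:R * y * a - x * a) * x ^+ n.+1 by rewrite !exprS; ring.
  apply: difference_image_fixedM tau_q2 _.
  by rewrite -[x ^+ _]mulr1 -(expr0 a); apply: lower_x; lia.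
have hy : I (y * (x ^+ n.+1 * a)).
  apply: (@cancel n.+4); first lia.
  have := difference_imageB h q; congr I; ring.
split=> //; apply: difference_imageDl (h).
exact: difference_image_natM hy.
Qed.

Lemma step_x j : pure_image k j.
Proof.
case: j => [|j] hj; last exact: xS_image.
rewrite mulr1; case: (ltnP 1 k) => [/x0_y1[]//|le_k1].
have -> : k = 1%N by lia.
by exists y; rewrite tau_y expr1.
Qed.

Let step_x' n j : (n.+2 = k)%N -> I (x ^+ n.+2 * a ^+ j).
Proof. by move=> hk; have := @step_x j; rewrite -hk; apply; lia. Qed.

Let yS_image n j : (n + 2 = k)%N -> y_image n j.+1.
Proof.
rewrite addn2 => hk; case: j => [|j].
  have [_] := x0_y1 ltac:(lia).
  by rewrite -hk -addn2 addnK.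
apply: (@cancel n.+1); first lia.
by apply: difference_imageDr (difference_y j.+1 hk); exact: step_x'.
Qed.

Let difference_yy n j : (n + 4 = k)%N ->
  I (2%:R * (y * (x ^+ n.+2 * a ^+ j)) + n.+1%:R * (y ^+ 2 * (x ^+ n * a ^+ j.+1))).
Proof.
move=> hk; have tau_yy : tau (y ^+ 2) = y ^+ 2 + (2%:R * y * x + x ^+ 2).
  by rewrite rmorphXn tau_y /=; ring.
apply: (@difference_imageDl _ _ _ (x ^+ n.+3 * a ^+ j
    + n.+1%:R * (2%:R * (y * (x ^+ n.+1 * a ^+ j.+1)) + x ^+ n.+2 * a ^+ j.+1))).
  apply: difference_imageD; first by apply: lower_x; lia.
  apply/difference_image_natM/difference_imageD.
    by apply: difference_image_natM; apply: lower_y; lia.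
  by apply: lower_x; lia.
have /(_ _)/eq_difference_image := difference_expr (n := n) (j := j) tau_yy.
apply; last by rewrite !exprS; ring.
move=> l e hl he.
have -> : (y ^+ 2 + (2%:R * y * x + x ^+ 2)) * (x ^+ l * a ^+ e)
  = y ^+ 2 * (x ^+ l * a ^+ e) + (2%:R * (y * (x ^+ l.+1 * a ^+ e))
     + x ^+ l.+2 * a ^+ e) by rewrite !exprS; ring.
apply: difference_imageD; first by apply: lower_yy; lia.
apply: difference_imageD; last by apply: lower_x; lia.
by apply: difference_image_natM; apply: lower_y; lia.
Qed.

Let difference_z n j : (n + 3 = k)%N ->
  I (y * (x ^+ n.+1 * a ^+ j) + n.+1%:R * (z * (x ^+ n * a ^+ j.+1))).
Proof.
move=> hk.
apply: (@difference_imageDl _ _ _ (n.+1%:R * (y * (x ^+ n * a ^+ j.+1)))).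
  by apply: difference_image_natM; apply: lower_y; lia.
have /(_ _)/eq_difference_image := difference_expr (n := n) (j := j) tau_z.
apply; last by rewrite !exprS; ring.
move=> l e hl he; rewrite mulrDl.
by apply: difference_imageD; [apply: lower_z | apply: lower_y]; lia.
Qed.

Let difference_yz n j : (n + 5 = k)%N ->
  I (y ^+ 2 * (x ^+ n.+1 * a ^+ j) + z * (x ^+ n.+2 * a ^+ j)
     + n.+1%:R * (y * z * (x ^+ n * a ^+ j.+1))).
Proof.
move=> hk; have tau_yz : tau (y * z) = y * z + (y ^+ 2 + z * x + y * x).
  by rewrite rmorphM tau_y tau_z /=; ring.
apply: (@difference_imageDl _ _ _ (y * (x ^+ n.+2 * a ^+ j)
    + n.+1%:R * (y ^+ 2 * (x ^+ n * a ^+ j.+1) + z * (x ^+ n.+1 * a ^+ j.+1)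
                 + y * (x ^+ n.+1 * a ^+ j.+1)))).
  apply: difference_imageD; first by apply: lower_y; lia.
  apply/difference_image_natM/difference_imageD; last by apply: lower_y; lia.
  by apply: difference_imageD; [apply: lower_yy | apply: lower_z]; lia.
have /(_ _)/eq_difference_image := difference_expr (n := n) (j := j) tau_yz.
apply; last by rewrite !exprS; ring.
move=> l e hl he.
have -> : (y * z + (y ^+ 2 + z * x + y * x)) * (x ^+ l * a ^+ e)
  = y * z * (x ^+ l * a ^+ e) + (y ^+ 2 * (x ^+ l * a ^+ e)
     + (z * (x ^+ l.+1 * a ^+ e) + y * (x ^+ l.+1 * a ^+ e))).
  by rewrite !exprS; ring.
apply: difference_imageD; first by apply: lower_yz; lia.
apply: difference_imageD; first by apply: lower_yy; lia.
by apply: difference_imageD; [apply: lower_z | apply: lower_y]; lia.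
Qed.

Let difference_v n j : (n + 4 = k)%N ->
  I (z * (x ^+ n.+1 * a ^+ j) + n.+1%:R * (v * (x ^+ n * a ^+ j.+1))).
Proof.
move=> hk.
apply: (@difference_imageDl _ _ _ (n.+1%:R * (z * (x ^+ n * a ^+ j.+1)))).
  by apply: difference_image_natM; apply: lower_z; lia.
have /(_ _)/eq_difference_image := difference_expr (n := n) (j := j) tau_v.
apply; last by rewrite !exprS; ring.
move=> l e hl he; rewrite mulrDl.
by apply: difference_imageD; [apply: lower_v | apply: lower_z]; lia.
Qed.

(** Without a factor [a] and for an exponent of [x] at least 2, the unknowns are [y x^(k-2)] and
    [y^2 x^(k-4) a]. The value at [y^2 x^(k-3)] and the fixed quadric times [y x^(k-4)] give two
    relations, again with determinant k + 1 up to sign. *)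
Lemma step_y n j : (n + 2 = k)%N -> y_image n j.
Proof.
case: j => [|j] hk; last exact: yS_image.
case: n hk => [|[|n]] hk; first by exists z; rewrite tau_z expr0; ring.
  apply: (@cancel 2); first lia.
  apply: (@difference_imageDl _ _ _ (x ^+ 2 * a ^+ 0)); first by apply: lower_x; lia.
  by exists (y ^+ 2); rewrite rmorphXn tau_y /=; ring.
have h : I (y * (x ^+ n.+2 * a ^+ 0) - 2%:R * (y ^+ 2 * (x ^+ n * a))).
  apply: (@difference_imageDl _ _ _ (- (y * (x ^+ n.+1 * a ^+ 1)))).
    by apply: difference_imageN; apply: lower_y; lia.
  apply: eq_difference_image (difference_image_fixedM tau_q2 (@lower_y n 0 _)) _.
    lia.
  by rewrite !exprS; ring.
apply: difference_imageDl (h).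
apply/difference_imageN/difference_image_natM.
apply: (@cancel n.+4.+1); first lia.
have h2 := @difference_yy n 0 ltac:(lia).
apply: eq_difference_image (difference_imageB h2 (difference_image_natM 2 h)) _.
by ring.
Qed.

Let yyS_image n j : (n + 4 = k)%N -> yy_image n j.+1.
Proof.
move=> hk _; apply: (@cancel n.+1); first lia.
apply: difference_imageDr (difference_yy j hk).
by apply/difference_image_natM/step_y; lia.
Qed.

Let zS_image n j : (n + 3 = k)%N -> z_image n j.+1.
Proof.
move=> hk _; apply: (@cancel n.+1); first lia.
by apply: difference_imageDr (difference_z j hk); apply: step_y; lia.
Qed.

Lemma step_yz n j : (n + 5 = k)%N -> yz_image n j.
Proof.
case: j => [|[|j]] // hk _; apply: (@cancel n.+1); first lia.
apply: difference_imageDr (difference_yz j.+1 hk).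
by apply: difference_imageD; [apply: yyS_image | apply: zS_image]; lia.
Qed.

Lemma step_v n j : (n + 4 = k)%N -> v_image n j.
Proof.
case: j => [|[|j]] // hk _; apply: (@cancel n.+1); first lia.
by apply: difference_imageDr (difference_v j.+1 hk); apply: zS_image; lia.
Qed.

Let relation_i2 n : (n + 5 = k)%N ->
  I (y ^+ 2 * x ^+ n.+1 - 2%:R * (z * x ^+ n.+2) + 2%:R * (v * (x ^+ n.+1 * a))).
Proof.
move=> hk.
apply: (@difference_imageDl _ _ _ (- (y * (x ^+ n.+2 * a ^+ 0))
   + (3%:R * (z * (x ^+ n.+1 * a ^+ 1)) + y * (x ^+ n.+1 * a ^+ 1)))).
  apply: difference_imageD; first by apply/difference_imageN/lower_y; lia.
  apply: difference_imageD; last by apply: lower_y; lia.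
  by apply/difference_image_natM/lower_z; lia.
apply: eq_difference_image (difference_image_fixedM tau_i2 (@lower_x n.+1 0 _ _)) _.
- lia.
- lia.
by rewrite !exprS; ring.
Qed.

(* With r1, r2, r4 and r3 = q2 z x^(k-5), the linear system in degree 0 in a has
   determinant (k - 2) (k + 1).  As z x is not in the image, r3 is not available
   for k = 6, where q2 (z x + y^2) replaces it. *)
Let v1_image n : (n + 5 = k)%N -> I (v * (x ^+ n.+1 * a)).
Proof.
move=> hk.
have r1 := relation_i2 hk.
have r2 := @difference_v n.+1 0 _; have {r2} r2 := r2 ltac:(lia).
have r4 := difference_yz 0 hk.
have [Dn|n_neq1] := eqVneq n 1%N; last first.
  have r3 : I (z * x ^+ n.+2 - 2%:R * (y * z * (x ^+ n * a))).
    apply: (@difference_imageDl _ _ _ (- (z * (x ^+ n.+1 * a ^+ 1)))).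
      by apply: difference_imageN; apply: lower_z; lia.
    apply: eq_difference_image (difference_image_fixedM tau_q2 (@lower_z n 0 _ _)) _.
    - lia.
    - by rewrite n_neq1.
    by rewrite !exprS; ring.
  apply: (@cancel n.+3); first lia.
  apply: (@cancel n.+4.+2); first lia.
  apply: eq_difference_image (difference_imageB (difference_image_natM n.+4.+3 r2)
    (difference_imageD (difference_image_natM n.+1 r3)
    (difference_imageB (difference_image_natM 2 r4) (difference_image_natM 2 r1)))) _.
  by rewrite !exprS; ring.
subst n.
have r3 : I (z * x ^+ 3 + y ^+ 2 * x ^+ 2 - 2%:R * (y * z * (x * a))
             - 2%:R * (y ^+ 3 * a)).
  apply: (@difference_imageDl _ _ _ (- (z * (x ^+ 2 * a ^+ 1) + y ^+ 2 * (x ^+ 1 * a ^+ 1)))).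
    apply: difference_imageN.
    by apply: difference_imageD; [apply: lower_z | apply: lower_yy]; lia.
  have [_ [_ _ /(_ erefl) hE]] := IH (k' := 4) ltac:(lia).
  by apply: eq_difference_image (difference_image_fixedM tau_q2 hE) _; ring.
(* The replacement for r3 brings in [y^3 a]; the value at [y^3 x] serves to eliminate it. *)
have r5 : I (3%:R * (y ^+ 2 * x ^+ 2) + y ^+ 3 * a).
  apply: (@difference_imageDl _ _ _ (3%:R * (y * (x ^+ 3 * a ^+ 0)) + x ^+ 4 * a ^+ 0
     + (3%:R * (y ^+ 2 * (x ^+ 1 * a ^+ 1)) + (3%:R * (y * (x ^+ 2 * a ^+ 1))
         + x ^+ 3 * a ^+ 1)))).
    apply: difference_imageD; apply: difference_imageD.
    - by apply/difference_image_natM/lower_y; lia.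
    - by apply: lower_x; lia.
    - by apply/difference_image_natM/lower_yy; lia.
    apply: difference_imageD; first by apply/difference_image_natM/lower_y; lia.
    by apply: lower_x; lia.
  by exists (y ^+ 3 * x); rewrite rmorphM rmorphXn tau_y tau_x /=; ring.
(* The combination below equals 70 times [v x^2 a], and 70 = 2 * 5 * 7 is invertible because k = 6
   gives 7 < p. *)
apply: (@cancel 2); first lia.
apply: (@cancel 5); first lia.
apply: (@cancel 7); first lia.
apply: eq_difference_image (difference_imageB (difference_image_natM 18 r2)
   (difference_imageB (difference_imageD (difference_imageD r3
       (difference_image_natM 2 r5)) r4) (difference_image_natM 8 r1))) _.
by ring.
Qed.

Let z0_image n : (n + 5 = k)%N -> I (z * x ^+ n.+2).
Proof.
move=> hk; have r2 := @difference_v n.+1 0 ltac:(lia).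
have h := difference_image_natM n.+2 (v1_image hk).
by apply: eq_difference_image (difference_imageB r2 h) _; ring.
Qed.

Lemma step_z n j : (n + 3 = k)%N -> z_image n j.
Proof.
case: j => [|j] hk; last exact: zS_image.
case: n hk => [|[|n]] // hk _; first by exists v; rewrite tau_v; ring.
by rewrite mulr1; apply: z0_image; lia.
Qed.

Lemma step_yy n j : (n + 4 = k)%N -> yy_image n j.
Proof.
case: j => [|j] hk; last exact: yyS_image.
case: n hk => [|n] // hk _; have hk' : (n + 5 = k)%N by lia.
have h := difference_imageB (difference_image_natM 2 (z0_image hk'))
  (difference_image_natM 2 (v1_image hk')).
by apply: eq_difference_image (difference_imageD (relation_i2 hk') h) _; ring.
Qed.

Lemma step_exceptional : k = 4 -> I (y ^+ 2 + z * x).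
Proof.
move=> hk; apply: (@difference_imageDl _ _ _ (y * (x ^+ 1 * a ^+ 0))).
  by apply: lower_y; lia.
by exists (y * z); rewrite rmorphM tau_y tau_z /=; ring.
Qed.

End InductionStep.

Lemma coweight_imageP k : (k.+1 < p)%N -> coweight_image k.
Proof.
elim/ltn_ind: k => k IH hk.
have IH' k' : (k' < k)%N -> coweight_image k' by move=> h; apply: IH => //; lia.
split; split.
- by move=> j; apply: (@step_x k).
- by move=> i j; apply: step_y.
- by move=> i j; apply: step_yy.
- by move=> i j; apply: step_z.
- by move=> i j; apply: step_yz.
- by move=> i j; apply: step_v.
- exact: step_exceptional.
Qed.

(* The next four families are, up to nonzero factors, dual to the monomials
   X_4^i X_5^j, X_3 X_4^i X_5^j, X_2 X_4^i X_5^j and X_2 X_3 X_5^j modulo the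
   Hilbert ideal. *)
Lemma dual_X4_image i j : (i.+1 < p)%N -> (0 < i + j)%N -> I (x ^+ i * a ^+ j).
Proof. by move=> hi; have [[h _ _ _] _] := coweight_imageP hi; apply: h. Qed.

Lemma dual_X3X4_image i j : (i + 3 < p)%N -> I (y * (x ^+ i * a ^+ j)).
Proof. by move=> hi; have [[_ h _ _] _] := @coweight_imageP (i + 2) ltac:(lia); apply: h. Qed.

Lemma dual_X2X4_image i j : (i + 4 < p)%N ->
  I (z * (x ^+ i * a ^+ j) + i%:R * (y ^+ 2 * (x ^+ i.-1 * a ^+ j))).
Proof.
move=> hi; have [[_ _ _ hz] _] := @coweight_imageP (i + 3) ltac:(lia).
case: i hi hz => [|i] hi hz.
  by rewrite mul0r addr0; apply: hz.
have [nz|] := boolP (0 < i + j)%N.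
  apply: difference_imageD; first by apply: hz => //; lia.
  apply: difference_image_natM.
  by have [[_ _ hyy _] _] := @coweight_imageP (i + 4) ltac:(lia); apply: hyy.
(* What remains is [z x + y^2], whose summands do not lie in the image separately. *)
rewrite -eqn0Ngt addn_eq0 => /andP[/eqP-> /eqP->].
have [_ [_ _ /(_ erefl) hE]] := @coweight_imageP 4 ltac:(lia).
by apply: eq_difference_image hE _; ring.
Qed.

Lemma dual_X2X3_image j : I ((2%:R * (y * z) + y ^+ 2) * a ^+ j).
Proof.
by exists (z ^+ 2 * a ^+ j); rewrite rmorphM !rmorphXn tau_z tau_a /=; ring.
Qed.

End DualMonomials.

(** * The apolar pairing *)

Lemma mcoeffXM (n : nat) (R : comNzRingType) (m k : 'X_{1..n}) (f : {mpoly R[n]}) :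
  ('X_[m] * f)@_k = if (m <= k)%MM then f@_(k - m)%MM else 0.
Proof.
rewrite mulrC; case: ifP => [le_mk|/negbT nle].
  by rewrite -{1}(submK le_mk) addmC mcoeffMX.
apply/memN_msupp_eq0; apply: contra nle.
by rewrite (perm_mem (msuppMX f m)) => /mapP[m' _ ->]; exact: lem_addr.
Qed.

Lemma lem_mnm1 (n : nat) (i : 'I_n) (m : 'X_{1..n}) : (U_(i) <= m)%MM = (0 < m i)%N.
Proof.
apply/mnm_lepP/idP => [/(_ i)|mi j]; first by rewrite mnm1E eqxx.
by rewrite mnm1E; case: eqP => // <-.
Qed.

(** Multiplying by one variable at a time suits statements about ring morphisms and derivations
    better than induction over monomials. *)
Lemma mpoly_ring_ind (n : nat) (R : comNzRingType) (P : {mpoly R[n]} -> Prop) :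
  (forall c p q, P p -> P q -> P (c *: p + q)) -> P 1 ->
  (forall i p, P p -> P ('X_i * p)) -> forall p, P p.
Proof.
move=> Plin P1 PX; have P0 : P 0 by rewrite -(subrr 1) addrC -scaleN1r; apply: Plin.
elim/mpolyind=> // c m p _ _ Pp; apply: Plin => // {p Pp c}.
move Dd: (mdeg m) => d; elim: d m Dd => [|d IHd] m Dd.
  by move/eqP: Dd; rewrite mdeg_eq0 => /eqP->; rewrite mpolyX0.
have [i mi] : exists i, (0 < m i)%N.
  apply/existsP; apply: contra_eqT Dd => /existsPn m0.
  by rewrite mdegE big1 // => i _; apply/eqP; rewrite -leqn0 leqNgt; apply: m0.
have le_im : (U_(i) <= m)%MM by rewrite lem_mnm1.
rewrite -(submK le_im) addmC mpolyXD; apply/PX/IHd.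
by move/eqP: Dd; rewrite -{1}(submK le_im) mdegD mdeg1 addn1 eqSS => /eqP.
Qed.

Section ApolarPairing.
Variables (n : nat) (R : comNzRingType).
Local Notation P := {mpoly R[n]}.

Definition mfact (m : 'X_{1..n}) : nat := \prod_(i < n) (m i)`!.

Lemma mfact_subU (i : 'I_n) (m : 'X_{1..n}) : (0 < m i)%N -> (m i * mfact (m - U_(i)) = mfact m)%N.
Proof.
move=> mi; rewrite /mfact (bigD1 i) //= [in RHS](bigD1 i) //= mulnA; congr (_ * _)%N.
  by rewrite mnmBE mnm1E eqxx subn1 -{1 3}(prednK mi) factS.
by apply: eq_bigr => j /negPf ne; rewrite mnmBE mnm1E eq_sym ne subn0.
Qed.

(** The factorials make multiplication by a variable adjoint to differentiation, and therefore the
    transpose of a linear substitution is again an algebra morphism. The price in characteristic p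
    is degeneracy once an exponent reaches p, so the pairing is exploited below that range only. *)
Definition apolar (u f : P) : R := \sum_(m <- msupp f) f@_m * (u@_m *+ mfact m).

Lemma apolar_linearl f c u w : apolar (c *: u + w) f = c * apolar u f + apolar w f.
Proof.
rewrite /apolar mulr_sumr -big_split /=; apply: eq_bigr => m _.
by rewrite mcoeffD mcoeffZ mulrnDl mulrDr -mulrnAr mulrCA.
Qed.

Lemma apolarE u f k : (msize f <= k)%N ->
  apolar u f = \sum_(m : 'X_{1..n < k}) f@_m * (u@_m *+ mfact m).
Proof.
move=> le_fk; set J : subFinType _ := 'X_{1..n < k}.
rewrite /apolar (big_mksub J) ?msupp_uniq //=; first last.
  by move=> m /msize_mdeg_lt /leq_trans; apply.
rewrite big_rmcond //= => j /memN_msupp_eq0 ->.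
by rewrite mul0r.
Qed.

Lemma apolar_linearr u c f g : apolar u (c *: f + g) = c * apolar u f + apolar u g.
Proof.
pose_big_enough k.
  rewrite !(@apolarE _ _ k) // mulr_sumr -big_split /=; apply: eq_bigr => m _.
  by rewrite mcoeffD mcoeffZ mulrDl mulrA.
by close.
Qed.

Lemma apolarX u m : apolar u 'X_[m] = u@_m *+ mfact m.
Proof. by rewrite /apolar msuppX big_seq1 mcoeffX eqxx mul1r. Qed.

Lemma apolar_X m f : apolar 'X_[m] f = f@_m *+ mfact m.
Proof.
pose_big_enough k.
  have hk : (mdeg m < k)%N by [].
  rewrite (@apolarE _ _ k) // (bigD1 (BMultinom hk)) //= mcoeffX eqxx.
  rewrite big1 ?addr0 ?mulr_natr // => m' /negPf ne; rewrite mcoeffX.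
  by rewrite bmeqP eq_sym /= in ne; rewrite ne mul0rn mulr0.
by close.
Qed.

Lemma apolarDl u w f : apolar (u + w) f = apolar u f + apolar w f.
Proof. by rewrite -[u]scale1r apolar_linearl mul1r scale1r. Qed.

Lemma apolarDr u f g : apolar u (f + g) = apolar u f + apolar u g.
Proof. by rewrite -[f]scale1r apolar_linearr mul1r scale1r. Qed.

Lemma apolar0l f : apolar 0 f = 0.
Proof. by apply: (addrI (apolar 0 f)); rewrite -apolarDl !addr0. Qed.

Lemma apolar0r u : apolar u 0 = 0.
Proof. by apply: (addrI (apolar u 0)); rewrite -apolarDr !addr0. Qed.

Lemma apolar_natMl k u f : apolar (k%:R * u) f = k%:R * apolar u f.
Proof.
by rewrite mulr_natl -scaler_nat -[_ *: u]addr0 apolar_linearl apolar0l addr0.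
Qed.

Lemma apolar_XM i u f : apolar ('X_i * u) f = apolar u f^`M(i).
Proof.
elim/mpolyind: f => [|c m f _ _ IHf].
  by rewrite mderiv0 !apolar0r.
rewrite apolar_linearr raddfD /= mderivZ apolar_linearr IHf mderivX.
congr (c * _ + _); rewrite -[_ *: 'X_[_]]addr0 apolar_linearr !apolarX.
rewrite apolar0r addr0 mcoeffXM lem_mnm1; case: (posnP (m i)) => [->|mi_gt0].
  by rewrite mul0r mul0rn.
by rewrite mulr_natl -mulrnA -(mfact_subU mi_gt0) mulnC.
Qed.

End ApolarPairing.

(* The transpose of [sigma] with respect to the apolar pairing. *)
Section Transpose.
Variables (F : fieldType) (n : nat).
Local Notation P := {mpoly F[n]}.

Definition Delta_dual_var (i : 'I_n) : P := \sum_(j < n | i.+1 == j :> nat) 'X_j.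

Definition sigma_dual : P -> P := comp_mpoly [tuple 'X_i + Delta_dual_var i | i < n].

HB.instance Definition _ := GRing.RMorphism.on sigma_dual.

Lemma sigma_dualM u w : sigma_dual (u * w) = sigma_dual u * sigma_dual w.
Proof. exact: rmorphM. Qed.

Lemma sigma_dualX i : sigma_dual 'X_i = 'X_i + Delta_dual_var i.
Proof. by rewrite /sigma_dual comp_mpolyXU -tnth_nth tnth_mktuple. Qed.

Lemma sigmaX i : sigma 'X_i = 'X_i + @Delta_var F n i.
Proof. by rewrite /sigma comp_mpolyXU -tnth_nth tnth_mktuple. Qed.

Lemma mderivXU (k i : 'I_n) : ('X_k : P)^`M(i) = (k == i)%:R.
Proof.
rewrite mderivX mnm1E; case: eqP => [->|_]; last by rewrite scale0r.
suff -> : (U_(i) - U_(i))%MM = 0%MM by rewrite mpolyX0 scale1r.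
by apply/mnmP => j; rewrite mnmBE subnn mnm0E.
Qed.

(** The derivation adjoint to multiplication by [sigma_dual 'X_i]; it is also what the chain rule
    for [sigma] produces. *)
Definition shifted_mderiv i (f : P) : P :=
  f^`M(i) + \sum_(j < n | i.+1 == j :> nat) f^`M(j).

Lemma shifted_mderiv_linear i c f g :
  shifted_mderiv i (c *: f + g) = c *: shifted_mderiv i f + shifted_mderiv i g.
Proof.
rewrite /shifted_mderiv mderivD mderivZ scalerDr.
under eq_bigr => j _ do rewrite mderivD mderivZ.
by rewrite big_split /= -scaler_sumr addrACA.
Qed.

Lemma shifted_mderivM i f g :
  shifted_mderiv i (f * g) = shifted_mderiv i f * g + f * shifted_mderiv i g.
Proof.
rewrite /shifted_mderiv mderivM mulrDl mulrDr.
under eq_bigr => j _ do rewrite mderivM.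
by rewrite big_split /= -mulr_suml -mulr_sumr addrACA.
Qed.

Lemma sum_delta (Q : pred 'I_n) k : \sum_(j < n | Q j) (j == k)%:R = (Q k)%:R :> P.
Proof.
have [Qk|nQk] := boolP (Q k).
  rewrite (bigD1 k) //= eqxx big1 ?addr0 // => j /andP[_ /negPf ->] //.
by rewrite big1 // => j Qj; case: eqP => // Dj; rewrite -Dj Qj in nQk.
Qed.

Lemma shifted_mderivX i k :
  shifted_mderiv i 'X_k = (k == i)%:R + (i.+1 == k :> nat)%:R.
Proof.
rewrite /shifted_mderiv mderivXU; under eq_bigr => j _ do rewrite mderivXU eq_sym.
by rewrite sum_delta.
Qed.

Lemma mderiv_sigmaX i k : (sigma 'X_k)^`M(i) = shifted_mderiv i 'X_k.
Proof.
rewrite sigmaX shifted_mderivX mderivD mderivXU /Delta_var raddf_sum /=.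
by under eq_bigr => j _ do rewrite mderivXU; rewrite sum_delta.
Qed.

Lemma sigmaM (f g : P) : sigma (f * g) = sigma f * sigma g.
Proof. exact: rmorphM. Qed.

Lemma sigmaD (f g : P) : sigma (f + g) = sigma f + sigma g.
Proof. exact: comp_mpolyD. Qed.

Lemma sigmaZ c (f : P) : sigma (c *: f) = c *: sigma f.
Proof. exact: comp_mpolyZ. Qed.

Lemma sigma1 : sigma 1 = 1 :> P.
Proof. exact: comp_mpoly1. Qed.

Lemma mderiv_sigma i (f : P) : (sigma f)^`M(i) = sigma (shifted_mderiv i f).
Proof.
elim/mpoly_ring_ind: f => [c p q IHp IHq||k f IHf].
- by rewrite shifted_mderiv_linear 2!sigmaD 2!sigmaZ mderivD mderivZ IHp IHq.
- rewrite /shifted_mderiv big1 => [|j _]; last by rewrite -mpolyC1 mderivC.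
  by rewrite addr0 sigma1 -mpolyC1 mderivC /sigma comp_mpoly0.
rewrite shifted_mderivM sigmaD 3!sigmaM mderivM mderiv_sigmaX IHf; congr (_ * _ + _).
by rewrite shifted_mderivX sigmaD /sigma -!mpolyC_nat !comp_mpolyC.
Qed.

Lemma mcoeff0_sigma (f : P) : (sigma f)@_0 = f@_0.
Proof.
elim/mpoly_ring_ind: f => [c p q IHp IHq||k f IHf].
- by rewrite sigmaD sigmaZ !mcoeffD !mcoeffZ IHp IHq.
- by rewrite sigma1.
have X0 i : ('X_i : P)@_0 = 0.
  by rewrite mcoeffX -mdeg_eq0 mdeg1.
rewrite sigmaM !rmorphM /= X0 mul0r sigmaX mcoeffD X0 raddf_sum /=.
by rewrite big1 ?addr0 ?mul0r.
Qed.

(** For u = 1 both sides are the constant term of f. A factor X_i of u becomes a derivative of f,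
    which [mderiv_sigma] carries across [sigma]. *)
Lemma apolar_sigma (u f : P) : apolar (sigma_dual u) f = apolar u (sigma f).
Proof.
elim/mpoly_ring_ind: u f => [c p q IHp IHq||i u IHu] f.
- by rewrite /sigma_dual comp_mpolyD comp_mpolyZ !apolar_linearl -!/(sigma_dual _) IHp IHq.
- by rewrite /sigma_dual comp_mpoly1 -mpolyX0 !apolar_X mcoeff0_sigma.
rewrite apolar_XM mderiv_sigma -IHu sigma_dualM sigma_dualX mulrDl apolarDl apolar_XM.
rewrite apolarDr; congr (_ + _); rewrite /Delta_dual_var.
elim/big_rec2: _ => [|j f1 u1 _ IH]; first by rewrite mul0r apolar0l apolar0r.
by rewrite mulrDl apolarDl apolarDr IH apolar_XM.
Qed.

Lemma apolar_invariant (f u : P) :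
  Defs.invariant f -> difference_image sigma_dual u -> apolar u f = 0.
Proof.
move=> /(_ 1) /= inv_f [w hw]; apply: (addrI (apolar w f)).
by rewrite -apolarDl -hw apolar_sigma inv_f addr0.
Qed.

End Transpose.

(** * Functionals that vanish on the Hilbert ideal *)

Definition mexp (a b c d e : nat) : 'X_{1..5} :=
  [multinom nth 0%N [:: a; b; c; d; e] i | i < 5].

Lemma mexpE a b c d e (i : 'I_5) : mexp a b c d e i = nth 0%N [:: a; b; c; d; e] i.
Proof. exact: mnmE. Qed.

Lemma ord5P (Q : 'I_5 -> Prop) :
  Q (inord 0) -> Q (inord 1) -> Q (inord 2) -> Q (inord 3) -> Q (inord 4) ->
  forall i, Q i.
Proof.
move=> Q0 Q1 Q2 Q3 Q4 i; rewrite -[i]inord_val.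
by case: i => [[|[|[|[|[|]]]]]].
Qed.

Lemma mexpK (m : 'X_{1..5}) :
  m = mexp (m (inord 0)) (m (inord 1)) (m (inord 2)) (m (inord 3)) (m (inord 4)).
Proof. by apply/mnmP; elim/ord5P; rewrite mexpE inordK. Qed.

Lemma mexpP (Q : 'X_{1..5} -> Prop) :
  (forall a b c d e, Q (mexp a b c d e)) -> forall m, Q m.
Proof. by move=> h m; rewrite [m]mexpK. Qed.

Lemma mexp_U (k : nat) : (k < 5)%N ->
  U_(inord k)%MM = mexp (k == 0) (k == 1) (k == 2) (k == 3) (k == 4).
Proof.
move=> hk; apply/mnmP => i; rewrite mexpE mnm1E -(inj_eq val_inj) /= inordK //.
by move: k hk; elim/ord5P: i => -[|[|[|[|[|]]]]]; rewrite inordK.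
Qed.

Lemma mexpD a b c d e a' b' c' d' e' :
  (mexp a b c d e + mexp a' b' c' d' e')%MM
  = mexp (a + a') (b + b') (c + c') (d + d') (e + e').
Proof. by apply/mnmP; elim/ord5P; rewrite mnmDE !mexpE inordK. Qed.

Lemma mexpB a b c d e a' b' c' d' e' :
  (mexp a b c d e - mexp a' b' c' d' e')%MM
  = mexp (a - a') (b - b') (c - c') (d - d') (e - e').
Proof. by apply/mnmP; elim/ord5P; rewrite mnmBE !mexpE inordK. Qed.

Lemma mexpMn a b c d e k :
  (mexp a b c d e *+ k)%MM = mexp (a * k) (b * k) (c * k) (d * k) (e * k).
Proof. by apply/mnmP; elim/ord5P; rewrite mulmnE !mexpE inordK. Qed.

Lemma mexp_le a b c d e a' b' c' d' e' :
  (mexp a b c d e <= mexp a' b' c' d' e')%MM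
  = [&& a <= a', b <= b', c <= c', d <= d' & e <= e']%N.
Proof.
apply/mnm_lepP/and5P => [h|[h0 h1 h2 h3 h4]]; last first.
  by elim/ord5P; rewrite !mexpE inordK.
by split; [have := h (inord 0) | have := h (inord 1) | have := h (inord 2)
  | have := h (inord 3) | have := h (inord 4)]; rewrite !mexpE inordK.
Qed.

Lemma big_ord5 (T : Type) (idx : T) (op : Monoid.law idx) (f : 'I_5 -> T) :
  \big[op/idx]_(i < 5) f i
  = op (f (inord 0)) (op (f (inord 1)) (op (f (inord 2)) (op (f (inord 3)) (f (inord 4))))).
Proof.
rewrite !big_ord_recl big_ord0 Monoid.mulm1.
by do ![congr (op _ _)]; congr f; apply: val_inj; rewrite /= inordK.
Qed.

Lemma mdeg_mexp a b c d e : mdeg (mexp a b c d e) = (a + b + c + d + e)%N.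
Proof. by rewrite mdegE big_ord5 !mexpE !inordK //= !addnA. Qed.

Lemma mexp_inj a b c d e a' b' c' d' e' : mexp a b c d e = mexp a' b' c' d' e' ->
  [/\ a = a', b = b', c = c', d = d' & e = e'].
Proof.
move/mnmP=> h; split; [have := h (inord 0) | have := h (inord 1) | have := h (inord 2)
  | have := h (inord 3) | have := h (inord 4)]; by rewrite !mexpE inordK.
Qed.

Lemma mexp_eq a b c d e a' b' c' d' e' :
  (mexp a b c d e == mexp a' b' c' d' e')
  = [&& a == a', b == b', c == c', d == d' & e == e'].
Proof.
apply/eqP/and5P => [/mexp_inj[]|[]]; first by do 5!move=> ->.
by do 5!move=> /eqP->.
Qed.

Lemma mfact_mexp a b c d e : mfact (mexp a b c d e) = (a`! * (b`! * (c`! * (d`! * e`!))))%N.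
Proof. by rewrite /mfact big_ord5 !mexpE !inordK. Qed.

Section FiveVariables.
Variable R : comNzRingType.
Local Notation P := {mpoly R[5]}.

Lemma mpolyX_mexp a b c d e : 'X_[mexp a b c d e] =
  'X_(inord 0) ^+ a * ('X_(inord 1) ^+ b * ('X_(inord 2) ^+ c
    * ('X_(inord 3) ^+ d * 'X_(inord 4) ^+ e))) :> P.
Proof. by rewrite mpolyXE_id big_ord5 !mexpE !inordK. Qed.

Lemma mcoeff_X1M (f : P) a b c d e : ('X_(inord 0) * f)@_(mexp a b c d e)
  = if a is a'.+1 then f@_(mexp a' b c d e) else 0.
Proof. by rewrite mcoeffXM mexp_U // mexp_le mexpB /=; case: a => *; rewrite ?subn0 ?subn1. Qed.

Lemma mcoeff_X2M (f : P) a b c d e : ('X_(inord 1) * f)@_(mexp a b c d e)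
  = if b is b'.+1 then f@_(mexp a b' c d e) else 0.
Proof. by rewrite mcoeffXM mexp_U // mexp_le mexpB /=; case: b => *; rewrite ?subn0 ?subn1. Qed.

Lemma mcoeff_X3M (f : P) a b c d e : ('X_(inord 2) * f)@_(mexp a b c d e)
  = if c is c'.+1 then f@_(mexp a b c' d e) else 0.
Proof. by rewrite mcoeffXM mexp_U // mexp_le mexpB /=; case: c => *; rewrite ?subn0 ?subn1. Qed.

Lemma mcoeff_X4M (f : P) a b c d e : ('X_(inord 3) * f)@_(mexp a b c d e)
  = if d is d'.+1 then f@_(mexp a b c d' e) else 0.
Proof. by rewrite mcoeffXM mexp_U // mexp_le mexpB /=; case: d => *; rewrite ?subn0 ?subn1. Qed.

Lemma mcoeff_X5M (f : P) a b c d e : ('X_(inord 4) * f)@_(mexp a b c d e)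
  = if e is e'.+1 then f@_(mexp a b c d e') else 0.
Proof. by rewrite mcoeffXM mexp_U // mexp_le mexpB /=; case: e => *; rewrite ?subn0 ?subn1. Qed.

End FiveVariables.

(** * The annihilator of the Hilbert ideal *)

Section Annihilator.
Variables (p : nat) (F : fieldType).
Hypotheses (p_gt5 : (5 < p)%N) (charF : p \in [pchar F]).
Local Notation P := {mpoly F[5]}.

(* These functionals span the annihilator of the Hilbert ideal; the additional
   terms reflect the relation X_3^2 = 2 X_4 X_2 + X_3 X_2. *)
Definition functional_X4 i j (f : P) : F := f@_(mexp 0 0 0 i j).
Definition functional_X3X4 i j (f : P) : F := f@_(mexp 0 0 1 i j).
Definition functional_X2X4 i j (f : P) : F :=
  f@_(mexp 0 1 0 i j) + (if i is i'.+1 then 2%:R * f@_(mexp 0 0 2 i' j) else 0).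
Definition functional_X2X3 j (f : P) : F := f@_(mexp 0 1 1 0 j) + f@_(mexp 0 0 2 0 j).

Definition annihilated (f : P) : Prop := forall j, (j < p)%N ->
  [/\ forall i, (i + 1 < p)%N -> functional_X4 i j f = 0,
      forall i, (i + 3 < p)%N -> functional_X3X4 i j f = 0,
      forall i, (i + 4 < p)%N -> functional_X2X4 i j f = 0
    & functional_X2X3 j f = 0].

Lemma annihilated_linear c f g :
  annihilated f -> annihilated g -> annihilated (c *: f + g).
Proof.
move=> Nf Ng j hj; have [f1 f2 f3 f4] := Nf j hj; have [g1 g2 g3 g4] := Ng j hj.
split=> [i hi|i hi|i hi|].
- move: (f1 i hi) (g1 i hi); rewrite /functional_X4 mcoeffD mcoeffZ => -> ->.
  by rewrite mulr0 addr0.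
- move: (f2 i hi) (g2 i hi); rewrite /functional_X3X4 mcoeffD mcoeffZ => -> ->.
  by rewrite mulr0 addr0.
- suff -> : functional_X2X4 i j (c *: f + g)
      = c * functional_X2X4 i j f + functional_X2X4 i j g.
    by rewrite f3 // g3 // mulr0 addr0.
  by rewrite /functional_X2X4; case: (i) => [|k]; rewrite !mcoeffD !mcoeffZ; ring.
- move: f4 g4; rewrite /functional_X2X3 !mcoeffD !mcoeffZ => f4 g4.
  by rewrite addrACA -mulrDr f4 g4 mulr0 addr0.
Qed.

(** Each functional, composed with multiplication by a variable, is zero or a combination of
    functionals of the list with admissible exponents. For instance, composing with X_3 turns
    [functional_X2X4 i.+1] into twice [functional_X3X4 i], and [functional_X2X3] into the sum of
    [functional_X2X4 0] and [functional_X3X4 0]. *)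
Lemma annihilatedM f g : annihilated f -> annihilated (g * f).
Proof.
move=> Nf; elim/mpoly_ring_ind: g => [c q r Nq Nr||i g].
- by rewrite mulrDl -scalerAl; apply: annihilated_linear.
- by rewrite mul1r.
rewrite -mulrA; move: (g * f) => {Nf f g} f Nf; elim/ord5P: i => j hj;
  have [f1 f2 f3 f4] := Nf j hj; rewrite /functional_X4 /functional_X3X4
    /functional_X2X4 /functional_X2X3.
- by split=> [i _|i _|[|i] _|]; rewrite !mcoeff_X1M ?mulr0 ?addr0.
- split=> [i hi|i hi|[|i] hi|]; rewrite !mcoeff_X2M //.
  + by rewrite addr0; apply: f1; lia.
  + by rewrite mulr0 addr0; apply: f1; lia.
  + by rewrite addr0; apply: f2; lia.
- split=> [i hi|i hi|[|i] hi|]; rewrite !mcoeff_X3M //.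
  + by apply: f1; lia.
  + by rewrite addr0.
  + by rewrite add0r [X in _ * X]f2 ?mulr0 //; lia.
  + have := f3 0%N ltac:(lia); have := f2 0%N ltac:(lia).
    by rewrite /functional_X3X4 /functional_X2X4 addr0 => -> ->; rewrite addr0.
- split=> [[|i] hi|[|i] hi|[|i] hi|]; rewrite !mcoeff_X4M ?addr0 //.
  + by apply: f1; lia.
  + by apply: f2; lia.
  + by have := f3 i ltac:(lia); rewrite /functional_X2X4; case: (i) => [|k]; rewrite ?mulr0.
case: j hj {f1 f2 f3 f4} => [|j] hj; split=> [i hi|i hi|[|i] hi|];
  rewrite !mcoeff_X5M ?mulr0 ?addr0 //; have [f1 f2 f3 f4] := Nf j (ltnW hj).
- exact: f1.
- exact: f2.
- by have := f3 _ hi; rewrite /functional_X2X4 addr0.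
- exact: (f3 _ hi).
- exact: f4.
Qed.

Let charP : p \in [pchar P].
Proof.
rewrite inE (pcharf_prime charF) /=; apply/eqP.
by rewrite -mpolyC_nat (pcharf0 charF).
Qed.

Lemma Delta_dual_varE k : (k < 5)%N ->
  Delta_dual_var F (inord k : 'I_5) = (if k == 4 then 0 else 'X_(inord k.+1)).
Proof.
move=> hk; rewrite /Delta_dual_var inordK //; case: eqP => [->|k4].
  by apply: big1 => i /eqP hi; have := ltn_ord i; rewrite -hi.
have hk' : (k.+1 < 5)%N by lia.
rewrite (bigD1 (inord k.+1)) /= ?inordK // big1 ?addr0 // => i /andP[/eqP hi /eqP[]].
by apply: val_inj; rewrite /= inordK.
Qed.

Let tau_X k : (k < 4)%N ->
  sigma_dual 'X_(inord k) = 'X_(inord k) + 'X_(inord k.+1) :> P.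
Proof.
by move=> hk; rewrite sigma_dualX Delta_dual_varE; [case: eqP => // Dk|]; lia.
Qed.

Let tau_a : sigma_dual 'X_(inord 4) = 'X_(inord 4) :> P.
Proof. by rewrite sigma_dualX Delta_dual_varE // addr0. Qed.

Let nonzero_fact k : (k < p)%N -> (k`!%:R : F) != 0.
Proof.
move=> hk; rewrite -(dvdn_pcharf charF); elim: k hk => [|k IHk] hk.
  by rewrite fact0 dvdn1; lia.
rewrite factS (Euclid_dvdM _ _ (pcharf_prime charF)) negb_or IHk ?andbT; last lia.
by rewrite gtnNdvd.
Qed.

(** Pairing f with the dual families gives the functionals up to factorials of numbers below p,
    which are cancelled. *)
Lemma annihilated_invariant (f : P) : homogeneous_invariant_pos f -> annihilated f.
Proof.
move=> [inv_f [d d_gt0 homog_f]] j hj.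
have apolar0 u : difference_image (@sigma_dual F 5) u -> apolar u f = 0.
  exact: apolar_invariant.
have cancel m c : (m < p)%N -> (c *+ (m`! * j`!) = 0 -> c = 0 :> F).
  move=> hm /eqP; rewrite -mulr_natr mulf_eq0 natrM mulf_eq0.
  by rewrite !(negPf (nonzero_fact _)) ?orbF // => /eqP.
have apolar_mexp b c i e : apolar ('X_(inord 1) ^+ b * ('X_(inord 2) ^+ c *
    ('X_(inord 3) ^+ i * 'X_(inord 4) ^+ e))) f
    = f@_(mexp 0 b c i e) *+ (b`! * (c`! * (i`! * e`!))).
  rewrite -[X in apolar X f]mul1r -(expr0 'X_(inord 0)) -mpolyX_mexp.
  by rewrite apolar_X mfact_mexp fact0 mul1n.
have [tx ty tz tv] := And4 (tau_X (k := 3) isT) (tau_X (k := 2) isT)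
  (tau_X (k := 1) isT) (tau_X (k := 0) isT).
split=> [i hi|i hi|i hi|].
(* For i = j = 0 the functional is evaluation at 0; here the positive degree of f is needed, since 1
   is not in the image of tau - 1. *)
- have [/eqP|ij_gt0] := posnP (i + j)%N.
    rewrite addn_eq0 => /andP[/eqP-> /eqP->]; apply: (dhomog_nemf_coeff homog_f).
    by rewrite /= mdeg_mexp; lia.
  apply: (cancel i); first lia.
  have := apolar0 _ (dual_X4_image charP tau_a tx ty tz tv (i := i) ltac:(lia) ij_gt0).
  by have := apolar_mexp 0 0 i j; rewrite !expr0 !mul1r fact0 !mul1n => ->.
- apply: (cancel i); first lia.
  have := apolar0 _ (dual_X3X4_image charP tau_a tx ty tz tv (i := i) j ltac:(lia)).
  by have := apolar_mexp 0 1 i j; rewrite expr0 expr1 !mul1r fact0 !mul1n => ->.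
- apply: (cancel i); first lia.
  have := apolar0 _ (dual_X2X4_image charP tau_a tx ty tz tv (i := i) j ltac:(lia)).
  rewrite apolarDl apolar_natMl /functional_X2X4.
  have := apolar_mexp 1 0 i j; rewrite expr0 expr1 !mul1r fact0 !mul1n => ->.
  case: i hi => [|i] hi; first by rewrite mul0r !addr0.
  have := apolar_mexp 0 2 i j; rewrite expr0 !mul1r fact0 mul1n factS => ->.
  by move=> <-; rewrite (erefl : 2`! = 2); move: i`! j`! => fi fj; ring.
apply: (cancel 2); first lia.
have := apolar0 _ (dual_X2X3_image tau_a tz j).
have -> : (2%:R * ('X_(inord 2) * 'X_(inord 1)) + 'X_(inord 2) ^+ 2) * 'X_(inord 4) ^+ j
  = 2%:R * ('X_(inord 1) ^+ 1 * ('X_(inord 2) ^+ 1 * ('X_(inord 3) ^+ 0 * 'X_(inord 4) ^+ j)))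
   + 'X_(inord 1) ^+ 0 * ('X_(inord 2) ^+ 2 * ('X_(inord 3) ^+ 0 * 'X_(inord 4) ^+ j)) :> P.
  by ring.
rewrite apolarDl apolar_natMl !apolar_mexp !(erefl : 1`! = 1) fact0 !mul1n => <-.
by rewrite /functional_X2X3 (erefl : 2`! = 2); move: j`! => fj; ring.
Qed.

Lemma annihilated_hilbert_ideal (f : P) : hilbert_ideal f -> annihilated f.
Proof.
case=> s [Ss ->]; rewrite big_seq; elim/big_ind: _ => [j hj|g h Ng Nh|q /Ss Sq].
- have Z k : (0 : P)@_k = 0 by rewrite mcoeff0.
  split=> [i _|i _|[|i] _|]; rewrite ?/functional_X4 ?/functional_X3X4
    ?/functional_X2X4 ?/functional_X2X3 !Z ?mulr0 ?addr0 //.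
- by rewrite -[g]scale1r; apply: annihilated_linear.
- exact/annihilatedM/annihilated_invariant.
Qed.

End Annihilator.

(** * Relations in the coinvariants *)

Section PowerSums.
Variables (R : comNzRingType) (p : nat).
Hypothesis charR : p \in [pchar R].

Lemma natr_pchar_cancel k (r : R) : (0 < k < p)%N -> k%:R * r = 0 -> r = 0.
Proof.
move=> /(natr_inv_pchar charR)[m mk] kr0.
by rewrite -[r]mul1r -mk -mulrA kr0 mulr0.
Qed.

Definition power_sum k : R := \sum_(c < p) c%:R ^+ k.

(** The sum of (c+1)^(k+1) - c^(k+1) over c < p telescopes to 0; after expansion, induction leaves
    only k + 1 times the power sum of order k. *)
Lemma power_sum_small k : (k.+1 < p)%N -> power_sum k = 0.
Proof.
elim/ltn_ind: k => k IHk hk; apply: (@natr_pchar_cancel k.+1); first lia.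
have tele : \sum_(c < p) (c.+1%:R ^+ k.+1 - c%:R ^+ k.+1) = 0 :> R.
  rewrite -(big_mkord xpredT (fun c => c.+1%:R ^+ k.+1 - c%:R ^+ k.+1 : R)).
  by rewrite telescope_sumr // (pcharf0 charR) !expr0n subrr.
rewrite -[RHS]tele; under [RHS]eq_bigr => c _.
  rewrite -natr1 exprD1n big_ord_recr /= binn mulr1n addrK.
  over.
rewrite exchange_big big_ord_recr /= big1 ?add0r => [|l _]; last first.
  by have hl := ltn_ord l; rewrite sumrMnl -/(power_sum l) IHk ?mul0rn //; lia.
by rewrite binSn sumrMnl mulr_natl.
Qed.

Lemma expr_nat_pchar c : c%:R ^+ p = c%:R :> R.
Proof. by rewrite -(pFrobenius_autE charR) rmorph_nat. Qed.

Lemma power_sum_pred : power_sum p.-1 = -1.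
Proof.
have p_gt1 := prime_gt1 (pcharf_prime charR).
rewrite /power_sum; case: p p_gt1 charR expr_nat_pchar => [|[|q]] // _ charq fermat.
rewrite big_ord_recl expr0n add0r (eq_bigr (fun=> 1)) => [|c _].
  rewrite sumr_const card_ord; apply/eqP; rewrite -subr_eq0 opprK natr1.
  by rewrite (pcharf0 charq).
have [m mk] := @natr_inv_pchar _ _ charq c.+1 ltac:(have := ltn_ord c; lia).
rewrite -[LHS]mul1r -{1}mk -mulrA -[_ * _ ^+ _]exprS.
by rewrite fermat.
Qed.

(** By Fermat the exponent drops by p - 1. Below 2 (p - 1) only the exponent p - 1 thus gives a
    nonzero power sum. *)
Lemma power_sum_large k : (p <= k)%N -> (k < (p.-1).*2)%N -> power_sum k = 0.
Proof.
move=> le_pk lt_k; rewrite -(@power_sum_small (k - p).+1); last lia.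
by apply: eq_bigr => c _; rewrite -{1}(subnK le_pk) exprD expr_nat_pchar exprSr.
Qed.

Variables x4 x5 : R.

Definition power_transfer k n : R := \sum_(c < p) c%:R ^+ k * (x5 + c%:R * x4) ^+ n.

(** In the binomial expansion only the term of degree p - 1 in c survives the summation over c. *)
Lemma power_transferE k n : (k < p)%N -> (k + n < (p.-1).*2)%N ->
  power_transfer k n = - ('C(n, p.-1 - k)%:R * (x5 ^+ (n - (p.-1 - k)) * x4 ^+ (p.-1 - k))).
Proof.
move=> lt_kp lt_kn; have p_gt1 := prime_gt1 (pcharf_prime charR).
rewrite /power_transfer.
transitivity (\sum_(l < n.+1) power_sum (k + l) * ('C(n, l)%:R * (x5 ^+ (n - l) * x4 ^+ l))).
  under eq_bigr => c _ do rewrite exprDn mulr_sumr.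
  rewrite exchange_big; apply: eq_bigr => l _; rewrite mulr_suml.
  by apply: eq_bigr => c _; rewrite exprMn -mulr_natl exprD; ring.
have z l : (l < n.+1)%N -> (l != p.-1 - k)%N -> power_sum (k + l) = 0.
  move=> hl ne; have [lt_p|ge_p] := ltnP (k + l) p.
    by apply: power_sum_small; lia.
  by apply: power_sum_large; lia.
have [lt|ge] := ltnP (p.-1 - k) n.+1; last first.
  rewrite bin_small // mul0r oppr0 big1 // => l _.
  by rewrite z ?mul0r //; have := ltn_ord l; lia.
rewrite (bigD1 (Ordinal lt)) //= big1 ?addr0 => [|l ne]; last first.
  by rewrite z ?mul0r.
by rewrite subnKC ?power_sum_pred ?mulN1r //; lia.
Qed.

End PowerSums.

(** * Vanishing products with powers of X_4, from the transfers of powers of X_5 *)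

Section Transfers.
Variables (R : comNzRingType) (p : nat).
Hypotheses (charR : p \in [pchar R]) (p_gt5 : (5 < p)%N).
Variables x2 x3 x4 x5 : R.
Hypotheses (sqr_x2 : x2 ^+ 2 = 0) (sqr_x3 : x3 ^+ 2 = 2%:R * x4 * x2 + x3 * x2)
  (x432 : x4 * x3 * x2 = 0).

Local Notation S := (power_transfer p x4 x5).

(** The transfer of X_5^n, that is, the sum of its images under the powers of sigma, with X_1 set to
    0. *)
Definition transfer_X5 n : R :=
  \sum_(c < p) (x5 + c%:R * x4 + 'C(c, 2)%:R * x3 + 'C(c, 3)%:R * x2) ^+ n.

Lemma sqr_x3_x2 : x3 ^+ 2 * x2 = 0.
Proof.
by rewrite sqr_x3; transitivity ((2%:R * x4 + x3) * x2 ^+ 2);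
  [ring | rewrite sqr_x2 mulr0].
Qed.

Let p_gt6 : (6 < p)%N.
Proof.
have p_neq6 : p != 6 by apply: contraTneq (pcharf_prime charR) => ->.
by lia.
Qed.

Lemma natr_bin2 c : 2%:R * 'C(c, 2)%:R = c%:R ^+ 2 - c%:R :> R.
Proof.
elim: c => [|c IHc]; first by rewrite expr0n mulr0 subr0.
by rewrite binS bin1 natrD mulrDr IHc; ring.
Qed.

Lemma natr_bin3 c : 6%:R * 'C(c, 3)%:R = c%:R ^+ 3 - 3%:R * c%:R ^+ 2 + 2%:R * c%:R :> R.
Proof.
elim: c => [|c IHc]; first by rewrite !expr0n !mulr0 subr0 addr0.
rewrite binS natrD mulrDr IHc.
have -> : 6%:R * 'C(c, 2)%:R = 3%:R * (2%:R * 'C(c, 2)%:R) :> R by ring.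
by rewrite natr_bin2; ring.
Qed.

Lemma expr_add_nilpotent (y N : R) n : N ^+ 3 = 0 ->
  (y + N) ^+ n = y ^+ n + n%:R * y ^+ n.-1 * N + 'C(n, 2)%:R * y ^+ n.-2 * N ^+ 2.
Proof.
move=> N3; elim: n => [|n IHn]; first by rewrite bin0n /=; ring.
rewrite exprSr IHn binS bin1 natrD; case: n {IHn} => [|[|n]] /=.
- by rewrite bin0n /=; ring.
- by rewrite bin_small //; ring.
rewrite !exprS; transitivity (y * (y * (y * y ^+ n)) + n.+3%:R * (y * (y * y ^+ n)) * N
  + ('C(n.+2, 2)%:R + n.+2%:R) * (y * y ^+ n) * N ^+ 2 + 'C(n.+2, 2)%:R * y ^+ n * N ^+ 3).
  by rewrite -!natr1; move: 'C(n.+2, 2) => b; ring.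
by rewrite N3; move: 'C(n.+2, 2) => b; ring.
Qed.

(** With N = C(c,2) x_3 + C(c,3) x_2, the relations give N^3 = 0 and make N^2 a combination of x_4
    x_2 and x_3 x_2. The binomials become polynomials in c at the cost of the factor w = 1/6, and
    summing over c yields the power transfers. *)
Lemma transfer_X5E w n : 6%:R * w = 1 ->
  transfer_X5 n = S 0 n
  + n%:R * w * (3%:R * ((S 2 n.-1 - S 1 n.-1) * x3)
                + (S 3 n.-1 - 3%:R * S 2 n.-1 + 2%:R * S 1 n.-1) * x2)
  + 'C(n, 2)%:R * w ^+ 2 *
     (9%:R * ((S 4 n.-2 - 2%:R * S 3 n.-2 + S 2 n.-2) * (2%:R * (x4 * x2) + x3 * x2))
      + 6%:R * ((S 5 n.-2 - 4%:R * S 4 n.-2 + 5%:R * S 3 n.-2 - 2%:R * S 2 n.-2)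
                * (x3 * x2))).
Proof.
move=> w6.
have term (c : nat) (y := x5 + c%:R * x4) :
  (y + 'C(c, 2)%:R * x3 + 'C(c, 3)%:R * x2) ^+ n = y ^+ n
  + n%:R * w * (3%:R * ((c%:R ^+ 2 - c%:R) * y ^+ n.-1 * x3)
                + (c%:R ^+ 3 - 3%:R * c%:R ^+ 2 + 2%:R * c%:R) * y ^+ n.-1 * x2)
  + 'C(n, 2)%:R * w ^+ 2 *
     (9%:R * ((c%:R ^+ 4 - 2%:R * c%:R ^+ 3 + c%:R ^+ 2) * y ^+ n.-2
               * (2%:R * (x4 * x2) + x3 * x2))
      + 6%:R * ((c%:R ^+ 5 - 4%:R * c%:R ^+ 4 + 5%:R * c%:R ^+ 3 - 2%:R * c%:R ^+ 2)
                 * y ^+ n.-2 * (x3 * x2))).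
  have Db : 'C(c, 2)%:R = 3%:R * w * (c%:R ^+ 2 - c%:R) :> R.
    by rewrite -natr_bin2 -[LHS]mul1r -[X in X * _ = _]w6; ring.
  have Dg : 'C(c, 3)%:R = w * (c%:R ^+ 3 - 3%:R * c%:R ^+ 2 + 2%:R * c%:R) :> R.
    by rewrite -natr_bin3 -[LHS]mul1r -[X in X * _ = _]w6; ring.
  have sqrN b g : (b * x3 + g * x2) ^+ 2
      = b ^+ 2 * (2%:R * (x4 * x2) + x3 * x2) + 2%:R * b * g * (x3 * x2).
    transitivity (b ^+ 2 * x3 ^+ 2 + 2%:R * b * g * (x3 * x2) + g ^+ 2 * x2 ^+ 2).
      by ring.
    by rewrite sqr_x2 sqr_x3; ring.
  rewrite -addrA expr_add_nilpotent; last first.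
    transitivity (('C(c, 2)%:R * x3 + 'C(c, 3)%:R * x2) ^+ 2
      * ('C(c, 2)%:R * x3 + 'C(c, 3)%:R * x2)).
      by rewrite exprSr.
    rewrite sqrN; move: ('C(c, 2)%:R : R) ('C(c, 3)%:R : R) => b g.
    transitivity (2%:R * b ^+ 3 * (x4 * x3 * x2) + (b ^+ 3 + 2%:R * b ^+ 2 * g) * (x3 ^+ 2 * x2)
       + (2%:R * b ^+ 2 * g * x4 + b ^+ 2 * g * x3 + 2%:R * b * g ^+ 2 * x3) * x2 ^+ 2).
      by ring.
    by rewrite x432 sqr_x3_x2 sqr_x2 !mulr0 !addr0.
  rewrite sqrN Db Dg; move: (y ^+ n) (y ^+ n.-1) (y ^+ n.-2) => t0 t1 t2.
  by move: 'C(n, 2) => b; ring.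
rewrite /transfer_X5 (eq_bigr _ (fun (c : 'I_p) _ => term c)).
have sumD (f g : 'I_p -> R) : \sum_c f c + \sum_c g c = \sum_c (f c + g c).
  by rewrite big_split.
have sumB (f g : 'I_p -> R) : \sum_c f c - \sum_c g c = \sum_c (f c - g c).
  by rewrite sumrB.
rewrite /power_transfer !(mulr_sumr, mulr_suml, sumD, sumB); apply: eq_bigr => c _.
by ring.
Qed.

Lemma power_transfer_x3x2 k n : (k < p.-1)%N -> (k + n < (p.-1).*2)%N -> S k n * (x3 * x2) = 0.
Proof.
move=> hk hn; rewrite power_transferE //; last lia.
have -> : (p.-1 - k = (p.-1 - k).-1.+1)%N by lia.
rewrite exprSr; move: (x5 ^+ _) (x4 ^+ _) (_%:R : R) => t5 t4 b.
transitivity (- (b * t5 * t4 * (x4 * x3 * x2))); first by ring.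
by rewrite x432 mulr0 oppr0.
Qed.

Lemma power_transfer_eq0 k n : (k < p.-1)%N -> (k + n < p.-1)%N -> S k n = 0.
Proof. by move=> hk hn; rewrite power_transferE ?bin_small ?mul0r ?oppr0 //; lia. Qed.

Lemma power_transfer_lead k n : (k + n = p.-1)%N -> (0 < n)%N -> S k n = - x4 ^+ n.
Proof.
move=> hkn n_gt0; rewrite (power_transferE charR); [|lia|lia].
by rewrite (_ : p.-1 - k = n)%N ?binn ?subnn ?expr0 ?mul1r //; lia.
Qed.

Lemma power_transfer_mul_eq0 k n l r : (k + l <= p.-1)%N -> (k + n < (p.-1).*2)%N ->
  x4 ^+ l * r = 0 -> S k n * r = 0.
Proof.
move=> hk hn xr0; have [l0|l_gt0] := posnP l.
  by move: xr0; rewrite l0 mul1r => ->; rewrite mulr0.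
rewrite power_transferE //; last lia.
rewrite -(subnK (_ : l <= p.-1 - k)%N); last lia.
by rewrite exprD mulNr -!mulrA xr0 !mulr0 oppr0.
Qed.

Hypothesis transfer0 : forall n, (0 < n)%N -> transfer_X5 n = 0.

Let cancel k (r : R) : (0 < k <= 6)%N -> k%:R * r = 0 -> r = 0.
Proof. by move=> hk; apply: (natr_pchar_cancel charR); lia. Qed.

Let natrBp k : (k <= p)%N -> (p - k)%:R = - k%:R :> R.
Proof. by move=> hk; rewrite natrB // (pcharf0 charR) sub0r. Qed.

Lemma transfer_X5_reduced w n : 6%:R * w = 1 -> (0 < n < p)%N ->
  0 = S 0 n
  + n%:R * w * (3%:R * ((S 2 n.-1 - S 1 n.-1) * x3)
                + (S 3 n.-1 - 3%:R * S 2 n.-1 + 2%:R * S 1 n.-1) * x2)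
  + 'C(n, 2)%:R * w ^+ 2 *
     (18%:R * ((S 4 n.-2 - 2%:R * S 3 n.-2 + S 2 n.-2) * (x4 * x2))).
Proof.
move=> w6 hn; rewrite -(@transfer0 n) ?(transfer_X5E _ w6); last lia.
congr (_ + _ * _).
have z k : (k <= 5)%N -> S k n.-2 * (x3 * x2) = 0 by move=> hk; apply: power_transfer_x3x2; lia.
have [z2 z3 z4 z5] := And4 (z 2 isT) (z 3 isT) (z 4 isT) (z 5 isT).
move: (S 2 _) (S 3 _) (S 4 _) (S 5 _) z2 z3 z4 z5 => s2 s3 s4 s5 z2 z3 z4 z5.
transitivity (18%:R * ((s4 - 2%:R * s3 + s2) * (x4 * x2))
  + 6%:R * (s5 * (x3 * x2)) - 15%:R * (s4 * (x3 * x2)) + 12%:R * (s3 * (x3 * x2))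
  - 3%:R * (s2 * (x3 * x2))); first by ring.
by rewrite z2 z3 z4 z5; ring.
Qed.

(** In the transfer of X_5^(p-3) just two power transfers survive, of orders 3 and 4, and both
    contribute multiples of the same monomial. *)
Lemma x4_pow_x2_eq0 : x4 ^+ (p - 4) * x2 = 0.
Proof.
have [m m6] := @natr_inv_pchar _ _ charR 6 ltac:(lia); rewrite mulrC in m6.
have := @transfer_X5_reduced _ (p - 3) m6 ltac:(lia).
have -> : (p - 3).-1 = (p - 4)%N by lia.
have -> : (p - 4).-1 = (p - 5)%N by lia.
rewrite (@power_transfer_lead 3) ?(@power_transfer_lead 4)
  ?(@power_transfer_eq0 0) ?(@power_transfer_eq0 1) ?(@power_transfer_eq0 2)
  ?(@power_transfer_eq0 3); try lia.
have -> : x4 ^+ (p - 4) = x4 * x4 ^+ (p - 5) by rewrite -exprS; congr (_ ^+ _); lia.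
have bin : 2%:R * 'C(p - 3, 2)%:R = 12%:R :> R.
  by rewrite natr_bin2 natrBp; [ring | lia].
rewrite natrBp; last lia.
move: (x4 ^+ _) ('C(_, _)%:R : R) bin => t b bin h.
(* The first-order term has coefficient 3/6 and the second-order one -6 * 18/36, in total -5/2.
   Multiplication by -36 clears the denominators and leaves 90 = 2 * 3 * 3 * 5. *)
apply: (@cancel 2) => //; apply: (@cancel 3) => //; apply: (@cancel 3) => //.
apply: (@cancel 5) => //; move/(congr1 ( *%R (- 36%:R))): h; rewrite mulr0 => ->.
transitivity ((9%:R * (6%:R * m%:R) ^+ 2 * (2%:R * b) - 18%:R * (6%:R * m%:R)) * (x4 * t * x2)).
  by rewrite m6 bin; ring.
by ring.
Qed.

(** In the transfer of X_5^(p-2) every term with x_2 carries at least x_4^(p-4), so the preceding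
    relation removes it. *)
Lemma x4_pow_x3_eq0 : x4 ^+ (p - 3) * x3 = 0.
Proof.
have [m m6] := @natr_inv_pchar _ _ charR 6 ltac:(lia); rewrite mulrC in m6.
have := @transfer_X5_reduced _ (p - 2) m6 ltac:(lia).
have -> : (p - 2).-1 = (p - 3)%N by lia.
have -> : (p - 3).-1 = (p - 4)%N by lia.
have x42 k : (k <= 3)%N -> S k (p - 3) * x2 = 0.
  by move=> hk; apply: power_transfer_mul_eq0 x4_pow_x2_eq0; lia.
have x442 k : (k <= 4)%N -> S k (p - 4) * (x4 * x2) = 0.
  move=> hk; apply: (@power_transfer_mul_eq0 _ _ (p - 5)); [lia | lia |].
  by rewrite mulrA -exprSr -x4_pow_x2_eq0; congr (_ ^+ _ * _); lia.
have -> : (S 4 (p - 4) - 2%:R * S 3 (p - 4) + S 2 (p - 4)) * (x4 * x2) = 0.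
  move: (x442 4 isT) (x442 3 isT) (x442 2 isT); move: (S 4 _) (S 3 _) (S 2 _) (x4 * x2).
  by move=> s4 s3 s2 r z4 z3 z2; rewrite mulrDl mulrBl -mulrA z4 z3 z2; ring.
have -> : (S 3 (p - 3) - 3%:R * S 2 (p - 3) + 2%:R * S 1 (p - 3)) * x2 = 0.
  move: (x42 3 isT) (x42 2 isT) (x42 1%N isT); move: (S 3 _) (S 2 _) (S 1 _).
  by move=> s3 s2 s1 z3 z2 z1; rewrite mulrDl mulrBl -!mulrA z3 z2 z1; ring.
rewrite !mulr0 !addr0.
rewrite (@power_transfer_lead 2) ?(@power_transfer_eq0 0) ?(@power_transfer_eq0 1) ?natrBp; try lia.
move: (x4 ^+ _) => t h.
apply: (@cancel 6) => //; move/(congr1 ( *%R 6%:R)): h; rewrite mulr0 => ->.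
by transitivity (6%:R * m%:R * 6%:R * (t * x3)); [rewrite m6 mul1r | ring].
Qed.

(** The two preceding relations remove every term of the transfer of X_5^(p-1) with x_2 or x_3; what
    is left is -x_4^(p-1). *)
Lemma x4_pow_eq0 : x4 ^+ (p - 1) = 0.
Proof.
have [m m6] := @natr_inv_pchar _ _ charR 6 ltac:(lia); rewrite mulrC in m6.
have := @transfer_X5_reduced _ (p - 1) m6 ltac:(lia).
have -> : (p - 1).-1 = (p - 2)%N by lia.
have -> : (p - 2).-1 = (p - 3)%N by lia.
have x42 k : (k <= 3)%N -> S k (p - 2) * x2 = 0.
  by move=> hk; apply: power_transfer_mul_eq0 x4_pow_x2_eq0; lia.
have x43 k : (k <= 2)%N -> S k (p - 2) * x3 = 0.
  by move=> hk; apply: power_transfer_mul_eq0 x4_pow_x3_eq0; lia.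
have x442 k : (k <= 4)%N -> S k (p - 3) * (x4 * x2) = 0.
  move=> hk; apply: (@power_transfer_mul_eq0 _ _ (p - 5)); [lia | lia |].
  by rewrite mulrA -exprSr -x4_pow_x2_eq0; congr (_ ^+ _ * _); lia.
have -> : (S 4 (p - 3) - 2%:R * S 3 (p - 3) + S 2 (p - 3)) * (x4 * x2) = 0.
  move: (x442 4 isT) (x442 3 isT) (x442 2 isT); move: (S 4 _) (S 3 _) (S 2 _) (x4 * x2).
  by move=> s4 s3 s2 r z4 z3 z2; rewrite mulrDl mulrBl -mulrA z4 z3 z2; ring.
have -> : (S 3 (p - 2) - 3%:R * S 2 (p - 2) + 2%:R * S 1 (p - 2)) * x2 = 0.
  move: (x42 3 isT) (x42 2 isT) (x42 1%N isT); move: (S 3 _) (S 2 _) (S 1 _).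
  by move=> s3 s2 s1 z3 z2 z1; rewrite mulrDl mulrBl -!mulrA z3 z2 z1; ring.
rewrite mulrBl !x43 // subrr !mulr0 !addr0 mulr0 addr0.
by rewrite (@power_transfer_lead 0); try lia; move/(congr1 -%R); rewrite oppr0 opprK.
Qed.

End Transfers.

(** * Explicit invariants and their relations in the coinvariants *)

Lemma to_coinvariants_eq0 (F : fieldType) n (f : {mpoly F[n]}) :
  (to_coinvariants f = 0) <-> hilbert_ideal f.
Proof.
rewrite /to_coinvariants -(rmorph0 (\pi_({ideal_quot hilbert_idealr F n}))%qT).
split=> [/eqP|/(hilbert_ideal_predP _) h]; last apply/eqP.
  by rewrite -Quotient.idealrBE subr0 => /hilbert_ideal_predP.
by rewrite -Quotient.idealrBE subr0.
Qed.

Lemma hilbert_ideal_generator (F : fieldType) n (f : {mpoly F[n]}) d :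
  (0 < d)%N -> f \is d.-homog -> sigma f = f -> hilbert_ideal f.
Proof.
move=> d_gt0 homog_f sigma_f; exists [:: (1, f)]; rewrite big_seq1 mul1r; split=> // q.
rewrite inE => /eqP->; split; last by exists d.
by elim=> //= k ->.
Qed.

Lemma big_iter_shift (A B : Type) (idx : B) (op : Monoid.com_law idx) (h : A -> B)
    (f : A -> A) x p : iter p f x = x ->
  \big[op/idx]_(c < p) h (iter c.+1 f x) = \big[op/idx]_(c < p) h (iter c f x).
Proof.
case: p => [|p] fx; first by rewrite !big_ord0.
by rewrite big_ord_recr big_ord_recl fx Monoid.mulmC.
Qed.

Section CoinvariantRelations.
Variables (p : nat) (F : fieldType).
Hypotheses (p_gt5 : (5 < p)%N) (charF : p \in [pchar F]).
Local Notation P := {mpoly F[5]}.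
Local Notation pi := (@to_coinvariants F 5).
Local Notation sigma5 := (@sigma F 5).
Local Notation X1 := ('X_(inord 0) : P).
Local Notation X2 := ('X_(inord 1) : P).
Local Notation X3 := ('X_(inord 2) : P).
Local Notation X4 := ('X_(inord 3) : P).
Local Notation X5 := ('X_(inord 4) : P).

Lemma Delta_varE k : (k < 5)%N ->
  Delta_var F (inord k : 'I_5) = (if k == 0 then 0 else 'X_(inord k.-1)).
Proof.
move=> hk; rewrite /Delta_var inordK //; case: eqP => [->|k0]; first by rewrite big1.
have hk' : (k.-1 < 5)%N by lia.
rewrite (bigD1 (inord k.-1)) /= ?inordK //; last by lia.
rewrite big1 ?addr0 // => i /andP[/eqP hi /eqP[]].
by apply: val_inj; rewrite /= inordK // -hi.
Qed.

Lemma sigma_X1 : sigma X1 = X1.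
Proof. by rewrite sigmaX Delta_varE ?addr0. Qed.
Lemma sigma_X2 : sigma X2 = X2 + X1. Proof. by rewrite sigmaX Delta_varE. Qed.
Lemma sigma_X3 : sigma X3 = X3 + X2. Proof. by rewrite sigmaX Delta_varE. Qed.
Lemma sigma_X4 : sigma X4 = X4 + X3. Proof. by rewrite sigmaX Delta_varE. Qed.
Lemma sigma_X5 : sigma X5 = X5 + X4. Proof. by rewrite sigmaX Delta_varE. Qed.

Lemma sigmaN (f : P) : sigma (- f) = - sigma f.
Proof. exact: comp_mpolyN. Qed.

Lemma sigma_nat k : sigma (k%:R : P) = k%:R.
Proof. by rewrite /sigma -mpolyC_nat comp_mpolyC. Qed.

Let sigmaE := (sigma_X1, sigma_X2, sigma_X3, sigma_X4, sigma_X5).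

Lemma homogX i : ('X_i : P) \is 1.-homog.
Proof. by rewrite dhomogX /= mdeg1. Qed.

Lemma homogXX i j : ('X_i * 'X_j : P) \is 2.-homog.
Proof. exact: (dhomogM (homogX i) (homogX j)). Qed.

Lemma homogXXX i j k : ('X_i * 'X_j * 'X_k : P) \is 3.-homog.
Proof. exact: (dhomogM (homogXX i j) (homogX k)). Qed.

Lemma homog_natM d k (f : P) : f \is d.-homog -> k%:R * f \is d.-homog.
Proof. by move=> hf; rewrite mulr_natl rpredMn. Qed.

Let piM (f g : P) : pi (f * g) = pi f * pi g.
Proof. exact: rmorphM. Qed.

Let piD (f g : P) : pi (f + g) = pi f + pi g.
Proof. exact: rmorphD. Qed.

Let piN (f : P) : pi (- f) = - pi f.
Proof. exact: rmorphN. Qed.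

Let piXn (f : P) n : pi (f ^+ n) = pi f ^+ n.
Proof. exact: rmorphXn. Qed.

Let pi_sum m (f : 'I_m -> P) : pi (\sum_(i < m) f i) = \sum_(i < m) pi (f i).
Proof. exact: raddf_sum. Qed.

Let pi0 : pi 0 = 0.
Proof. exact: rmorph0. Qed.

Let pi_nat k : pi k%:R = k%:R.
Proof. exact: rmorph_nat. Qed.

Let piE := (piD, piN, piM, pi_nat).

Lemma pchar_coinvariants : p \in [pchar (coinvariants F 5)].
Proof.
rewrite inE (pcharf_prime charF) /=; apply/eqP.
by rewrite -pi_nat -mpolyC_nat (pcharf0 charF) mpolyC0 pi0.
Qed.

Lemma pi_X1 : pi X1 = 0.
Proof. exact/to_coinvariants_eq0/(hilbert_ideal_generator _ (homogX _) sigma_X1). Qed.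

Lemma pi_X2_sqr : pi X2 ^+ 2 = 0.
Proof.
pose f := X2 * X2 - 2%:R * (X1 * X3) - X1 * X2.
have : pi f = 0.
  apply/to_coinvariants_eq0/(@hilbert_ideal_generator _ _ _ 2) => //.
    by rewrite !rpredB ?homog_natM ?homogXX.
  rewrite /f !(sigmaD, sigmaN, sigmaM, sigma_nat) !sigmaE; ring.
by rewrite /f !piE pi_X1; move=> <-; ring.
Qed.

Lemma pi_X3_sqr : pi X3 ^+ 2 = 2%:R * pi X4 * pi X2 + pi X3 * pi X2.
Proof.
pose f := X3 * X3 - 2%:R * (X2 * X4) + 2%:R * (X1 * X5) - X2 * X3 + 3%:R * (X1 * X4)
  + X1 * X3.
have : pi f = 0.
  apply/to_coinvariants_eq0/(@hilbert_ideal_generator _ _ _ 2) => //.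
    by do ?[exact: homogXX | apply: homog_natM | apply: rpredB | apply: rpredD].
  rewrite /f !(sigmaD, sigmaN, sigmaM, sigma_nat) !sigmaE; ring.
rewrite /f !piE pi_X1 => f0.
by rewrite -[RHS]addr0 -f0; ring.
Qed.

Lemma pi_X432 : pi X4 * pi X3 * pi X2 = 0.
Proof.
(* The catalecticant of the binary quartic, up to terms of lower weight. *)
pose f := 2%:R * (X3 * X3 * X3) - 6%:R * (X2 * X3 * X4) - 3%:R * (X2 * X3 * X3)
  + (X2 * X2 * X3 + 6%:R * (X2 * X2 * X4) + 6%:R * (X2 * X2 * X5))
  - 2%:R * (X1 * X1 * X3) - 6%:R * (X1 * X1 * X4) - 4%:R * (X1 * X1 * X5)
  + X1 * X2 * X3 - 2%:R * (X1 * X2 * X4) - 6%:R * (X1 * X2 * X5)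
  - 12%:R * (X1 * X3 * X5) + 9%:R * (X1 * X4 * X4).
have : pi f = 0.
  apply/to_coinvariants_eq0/(@hilbert_ideal_generator _ _ _ 3) => //.
    by do ?[exact: homogXXX | apply: homog_natM | apply: rpredB | apply: rpredD].
  rewrite /f !(sigmaD, sigmaN, sigmaM, sigma_nat) !sigmaE; ring.
rewrite /f !piE pi_X1; have := pi_X3_sqr; have := pi_X2_sqr.
move: (pi X2) (pi X3) (pi X4) (pi X5) => x2 x3 x4 x5 x22 x33 f0.
(* Reducing the cubic by the relations for X_3^2 and X_2^2 leaves -2 x_4 x_3 x_2; the cofactor 2 x_3
   - x_2 below is the quotient by the first relation. *)
apply: (natr_pchar_cancel pchar_coinvariants (k := 2)); first lia.
rewrite -[LHS]addr0 -[X in _ + X = _]f0.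
transitivity ((2%:R * x3 - x2) * (x3 ^+ 2 - (2%:R * x4 * x2 + x3 * x2))
  + x2 ^+ 2 * (4%:R * x4 + 6%:R * x5)); first by ring.
by rewrite x33 x22 subrr mulr0 mul0r addr0.
Qed.

Lemma iter_sigmaM c (f g : P) : iter c sigma5 (f * g) = iter c sigma5 f * iter c sigma5 g.
Proof. by elim: c => //= c ->; rewrite sigmaM. Qed.

Lemma iter_sigmaXn c (f : P) n : iter c sigma5 (f ^+ n) = iter c sigma5 f ^+ n.
Proof.
elim: n => [|n IHn]; last by rewrite !exprS iter_sigmaM IHn.
by elim: c => //= c ->; rewrite sigma1.
Qed.

Lemma iter_sigma_X5 c : iter c sigma5 X5 =
  X5 + c%:R * X4 + 'C(c, 2)%:R * X3 + 'C(c, 3)%:R * X2 + 'C(c, 4)%:R * X1.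
Proof.
elim: c => [|c IHc]; first by rewrite /= !mul0r !addr0.
rewrite iterS IHc !(sigmaD, sigmaM, sigma_nat) !sigmaE !binS bin1 !natrD.
by move: 'C(c, 2) 'C(c, 3) 'C(c, 4) => b2 b3 b4; rewrite -natr1; ring.
Qed.

Lemma iter_sigma_X5_homog c : iter c sigma5 X5 \is 1.-homog.
Proof.
rewrite iter_sigma_X5.
by do ?[exact: homogX | apply: homog_natM | apply: rpredD].
Qed.

Lemma iter_sigma_X5_p : iter p sigma5 X5 = X5.
Proof.
have p0 : p%:R = 0 :> P by rewrite -mpolyC_nat (pcharf0 charF).
have bin0 k : (0 < k < p)%N -> 'C(p, k)%:R = 0 :> P.
  move=> hk; have /dvdnP[q ->] := prime_dvd_bin (pcharf_prime charF) hk.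
  by rewrite natrM p0 mulr0.
by rewrite iter_sigma_X5 p0 !bin0 ?mul0r ?addr0 //; lia.
Qed.

Lemma pi_transfer n : (0 < n)%N -> transfer_X5 p (pi X2) (pi X3) (pi X4) (pi X5) n = 0.
Proof.
move=> n_gt0; have : pi (\sum_(c < p) iter c sigma5 (X5 ^+ n)) = 0.
  apply/to_coinvariants_eq0/(@hilbert_ideal_generator _ _ _ n) => //.
    apply: rpred_sum => c _; rewrite iter_sigmaXn.
    by have := dhomogMn n (iter_sigma_X5_homog c); rewrite mul1n.
  rewrite /sigma raddf_sum /= -/sigma.
  apply: (@big_iter_shift _ _ _ _ id sigma5).
  by rewrite iter_sigmaXn iter_sigma_X5_p.
rewrite pi_sum => <-; apply: eq_bigr => c _.
by rewrite iter_sigmaXn piXn iter_sigma_X5 !piE pi_X1 mulr0 addr0.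
Qed.

Lemma pi_X4X2 : pi X4 ^+ (p - 4) * pi X2 = 0.
Proof.
exact: (x4_pow_x2_eq0 pchar_coinvariants p_gt5 pi_X2_sqr pi_X3_sqr pi_X432 pi_transfer).
Qed.

Lemma pi_X4X3 : pi X4 ^+ (p - 3) * pi X3 = 0.
Proof.
exact: (x4_pow_x3_eq0 pchar_coinvariants p_gt5 pi_X2_sqr pi_X3_sqr pi_X432 pi_transfer).
Qed.

Lemma pi_X4_pow : pi X4 ^+ (p - 1) = 0.
Proof.
exact: (x4_pow_eq0 pchar_coinvariants p_gt5 pi_X2_sqr pi_X3_sqr pi_X432 pi_transfer).
Qed.

End CoinvariantRelations.

(** * The orbit polynomial of X_5 *)

Lemma orbit_poly_fixed (A : comNzRingType) (s : {rmorphism A -> A}) (x : A) p i :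
  iter p s x = x ->
  s (\prod_(c < p) ('X - (iter c s x)%:P))`_i = (\prod_(c < p) ('X - (iter c s x)%:P))`_i.
Proof.
move=> sx; rewrite -coef_map rmorph_prod; congr (_`_i).
under eq_bigr => c _ do rewrite rmorphB /= map_polyX map_polyC /= -iterS.
case: p sx => [|q] sx; first by rewrite !big_ord0.
by rewrite big_ord_recr big_ord_recl sx mulrC.
Qed.

HB.instance Definition _ (F : fieldType) n := GRing.RMorphism.copy (@sigma F n)
  (comp_mpoly [tuple 'X_i + Delta_var F i | i < n]).

Section PowerOfX5.
Variables (p : nat) (F : fieldType).
Hypotheses (p_gt5 : (5 < p)%N) (charF : p \in [pchar F]).
Local Notation P := {mpoly F[5]}.
Local Notation pi := (@to_coinvariants F 5).
Local Notation sigma5 := (@sigma F 5).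
Local Notation X5 := ('X_(inord 4) : P).

Lemma homog_coef_prod_XsubC (s : seq P) i : {in s, forall u, u \is 1.-homog} ->
  (i <= size s)%N -> (\prod_(u <- s) ('X - u%:P))`_i \is (size s - i).-homog.
Proof.
elim: s i => [|u s IHs] i homog_s le_is.
  by move: le_is; rewrite leqn0 => /eqP->; rewrite big_nil coefC /= dhomog1.
have {}IHs j : (j <= size s)%N -> (\prod_(u <- s) ('X - u%:P))`_j \is (size s - j).-homog.
  by apply: IHs => w ws; apply: homog_s; rewrite inE ws orbT.
rewrite big_cons mulrBl coefB coefXM coefCM /=; apply: rpredB.
  by case: i le_is => [|i] le_is; [exact: rpred0 | exact: IHs].
have [le|gt] := leqP i (size s); last first.
  by rewrite (nth_default _ _) ?mulr0 ?rpred0 // size_prod_XsubC.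
rewrite subSn //; apply: (dhomogM (d := 1) (e := size s - i) _ (IHs _ le)).
by apply: homog_s; rewrite inE eqxx.
Qed.

(* The coefficients of the monic polynomial with the conjugates of X_5 as roots
   are invariants. *)
Lemma pi_X5_pow : pi X5 ^+ p = 0.
Proof.
have p_gt0 : (0 < p)%N by lia.
pose s := [seq iter (c : 'I_p) sigma5 X5 | c <- enum 'I_p].
have size_s : size s = p by rewrite size_map size_enum_ord.
pose f := \prod_(u <- s) ('X - u%:P).
have fE : f = \prod_(c < p) ('X - (iter c sigma5 X5)%:P).
  by rewrite /f big_map big_enum.
have f_root : f.[X5] = 0.
  apply/rootP; rewrite root_prod_XsubC; apply/mapP; exists (Ordinal p_gt0).
    by rewrite mem_enum.
  exact: erefl.
have pi_coef i : (i < p)%N -> pi f`_i = 0.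
  move=> lt_ip; apply/to_coinvariants_eq0/(@hilbert_ideal_generator _ _ _ (p - i)).
  - by rewrite subn_gt0.
  - rewrite -size_s; apply: homog_coef_prod_XsubC; last by rewrite size_s ltnW.
    by move=> u /mapP[c _ ->]; apply: (iter_sigma_X5_homog p_gt5 charF).
  by rewrite {1}fE orbit_poly_fixed ?fE // (iter_sigma_X5_p p_gt5 charF).
have : pi f.[X5] = 0 by rewrite f_root; exact: rmorph0.
rewrite horner_coef size_prod_XsubC size_s big_ord_recr.
have lead_f : f`_p = 1.
  by have /monicP := monic_prod_XsubC s xpredT id; rewrite lead_coefE size_prod_XsubC size_s.
have piD (g h : P) : pi (g + h) = pi g + pi h by exact: rmorphD.
have piM (g h : P) : pi (g * h) = pi g * pi h by exact: rmorphM.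
have pi_sum (g : 'I_p -> P) : pi (\sum_(i < p) g i) = \sum_(i < p) pi (g i).
  exact: raddf_sum.
rewrite lead_f [LHS]piD [X in X + _]pi_sum big1 => [|i _]; last first.
  by rewrite piM pi_coef; [exact: mul0r | exact: (ltn_ord i)].
by rewrite add0r mul1r => <-; apply/esym; exact: rmorphXn.
Qed.

End PowerOfX5.

(** * The Gröbner basis *)

Section GrevlexOrder.
Variable n : nat.
Implicit Types m x r : 'X_{1..n}.

Lemma grevlex_ltP m1 m2 : mdeg m1 = mdeg m2 ->
  reflect (exists i : 'I_n, (m2 i < m1 i)%N /\ forall j : 'I_n, (j < i)%N -> m1 j = m2 j)
    (grevlex_lt m1 m2).
Proof.
move=> eq_deg; rewrite /grevlex_lt eq_deg ltnn eqxx /=.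
apply: (iffP existsP) => -[i]; last first.
  by case=> lt eq; exists i; rewrite lt; apply/forallP => j; apply/implyP => /eq->.
by case/andP=> lt /forallP eq; exists i; split=> // j ji; apply/eqP/(implyP (eq j)).
Qed.

Lemma grevlex_irr m : grevlex_lt m m = false.
Proof. by apply/negP => /grevlex_ltP[//|i []]; rewrite ltnn. Qed.

(** Equivalently, not being smaller is a transitive relation. In this form it handles the fold that
    defines [glead]: x is not below the maximum of the rest, which is not below m. *)
Lemma grevlex_cotrans r x m : grevlex_lt x m -> grevlex_lt x r || grevlex_lt r m.
Proof.
have [lt_xr _|lt_rx|eq_xr] := ltngtP (mdeg x) (mdeg r).
- by rewrite /grevlex_lt lt_xr.
- rewrite {1}/grevlex_lt => /orP[lt_xm|/andP[/eqP eq_xm _]].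
    by rewrite orbC {1}/grevlex_lt (ltn_trans lt_rx lt_xm).
  by rewrite orbC {1}/grevlex_lt -eq_xm lt_rx.
have [lt_xm _|lt_mx|eq_xm] := ltngtP (mdeg x) (mdeg m).
- by rewrite orbC /grevlex_lt -eq_xr lt_xm.
- by rewrite {1}/grevlex_lt ltnNge (ltnW lt_mx) /= gtn_eqF.
case/(grevlex_ltP eq_xm) => i [lt_i eq_i].
(* The least k in Q is the first variable at which r differs from x, unless x and m already differ
   there or earlier. All three monomials agree before k, and the exponents at k decide. *)
pose Q := [pred k : 'I_n | (k == i) || (r k != x k)].
have Qi : Q i by rewrite /= eqxx.
case: (arg_minnP (fun k : 'I_n => k : nat) Qi) => k Qk k_min.
have le_ki : (k <= i)%N := k_min _ Qi.
have {}k_min (j : 'I_n) : (j < k)%N -> r j = x j /\ (j < i)%N.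
  move=> lt_jk.
  split; last exact: leq_trans lt_jk le_ki.
  by apply/eqP; apply: contraLR lt_jk => ne; rewrite -leqNgt k_min //= ne orbT.
have eq_rm (j : 'I_n) : (j < k)%N -> r j = m j.
  by move=> /k_min[-> lt_ji]; apply: eq_i.
have eq_rm_deg : mdeg r = mdeg m by rewrite -eq_xr.
have [lt_rk|le_xk] := ltnP (r k) (x k).
  by apply/orP; left; apply/(grevlex_ltP eq_xr); exists k; split=> // j /k_min[].
apply/orP; right; apply/(grevlex_ltP eq_rm_deg); exists k; split=> //.
have [Dk|ne_ki] := eqVneq k i; first by rewrite Dk in le_xk *; apply: leq_trans le_xk.
have ne_rx : r k != x k by case/orP: Qk => // /eqP Dk; rewrite Dk eqxx in ne_ki.
have lt_ki : (k < i)%N by rewrite ltn_neqAle le_ki andbT; exact: ne_ki.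
by rewrite -(eq_i _ lt_ki) ltn_neqAle le_xk andbT eq_sym.
Qed.

Lemma grevlex_asym m1 m2 : grevlex_lt m1 m2 -> grevlex_lt m2 m1 = false.
Proof.
have [lt_deg _|gt_deg|eq_deg] := ltngtP (mdeg m1) (mdeg m2).
- by rewrite /grevlex_lt ltnNge (ltnW lt_deg) /= gtn_eqF.
- by rewrite /grevlex_lt ltnNge (ltnW gt_deg) /= gtn_eqF.
case/(grevlex_ltP eq_deg) => i [lt_i eq_i].
apply/negP => /(grevlex_ltP (esym eq_deg))[j [lt_j eq_j]].
case: (ltngtP i j) => [/eq_j e|/eq_i e|/val_inj e].
- by rewrite e ltnn in lt_i.
- by rewrite e ltnn in lt_j.
by move: lt_i; rewrite e ltnNge (ltnW lt_j).
Qed.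

Lemma grevlex_lt0 m : grevlex_lt m 0%MM = false.
Proof.
rewrite /grevlex_lt mdeg0 ltn0 /=; have [/eqP|//] := eqVneq (mdeg m) 0%N.
by rewrite mdeg_eq0 => /eqP->; apply/existsP => -[i]; rewrite ltnn.
Qed.

Section LeadingMonomial.
Variable R : nzRingType.
Implicit Type f : {mpoly R[n]}.

Lemma glead_msupp f : f != 0 -> glead f \in msupp f.
Proof.
rewrite -msupp_eq0 /glead; elim: (msupp f) => // x s IHs _.
rewrite big_cons /grevlex_max; case: ifP => [lt_x|_]; last exact: mem_head.
rewrite inE IHs ?orbT //; apply: contraTneq lt_x => ->.
by rewrite big_nil grevlex_lt0.
Qed.

Lemma glead_max f m : m \in msupp f -> ~~ grevlex_lt (glead f) m.
Proof.
rewrite /glead; elim: (msupp f) m => // x s IHs m.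
rewrite big_cons inE /grevlex_max.
case: ifP => [lt_x|nlt_x] /predU1P[->|ms].
- by rewrite grevlex_asym.
- exact: IHs.
- by rewrite grevlex_irr.
apply/negP => /(@grevlex_cotrans (\big[@grevlex_max n/0%MM]_(j <- s) j)).
by rewrite nlt_x (negPf (IHs _ ms)).
Qed.

Lemma glead_unique f m : m \in msupp f ->
  (forall m', m' \in msupp f -> m' != m -> grevlex_lt m' m) -> glead f = m.
Proof.
move=> mf m_max; apply/eqP; apply: contraTT (glead_max mf) => ne.
rewrite negbK m_max ?glead_msupp //.
by apply: contraTneq mf => ->; rewrite msupp0.
Qed.

Lemma gleadX m : glead ('X_[m] : {mpoly R[n]}) = m.
Proof. by rewrite /glead msuppX big_cons big_nil /grevlex_max grevlex_lt0. Qed.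

End LeadingMonomial.

End GrevlexOrder.

(** * Leading monomials, standard monomials and reducedness *)

Section GroebnerBasis.
Variables (p : nat) (F : fieldType).
Hypotheses (p_gt5 : (5 < p)%N) (charF : p \in [pchar F]).
Local Notation P := {mpoly F[5]}.
Local Notation pi := (@to_coinvariants F 5).

Definition quadric : P := 'X_(inord 2) ^+ 2 - 2%:R * 'X_(inord 3) * 'X_(inord 1)
  - 'X_(inord 2) * 'X_(inord 1).

Definition groebner_basis : seq P :=
  [:: 'X_(inord 0); 'X_(inord 1) ^+ 2; quadric;
      'X_(inord 3) * 'X_(inord 2) * 'X_(inord 1);
      'X_(inord 3) ^+ (p - 4) * 'X_(inord 1);
      'X_(inord 3) ^+ (p - 3) * 'X_(inord 2);
      'X_(inord 3) ^+ (p - 1); 'X_(inord 4) ^+ p].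

Definition lead_exponents : seq 'X_{1..5} :=
  [:: mexp 1 0 0 0 0; mexp 0 2 0 0 0; mexp 0 0 2 0 0; mexp 0 1 1 1 0;
      mexp 0 1 0 (p - 4) 0; mexp 0 0 1 (p - 3) 0; mexp 0 0 0 (p - 1) 0;
      mexp 0 0 0 0 p].

Lemma groebner_basisE : groebner_basis =
  [:: 'X_[mexp 1 0 0 0 0]; 'X_[mexp 0 2 0 0 0]; quadric; 'X_[mexp 0 1 1 1 0];
      'X_[mexp 0 1 0 (p - 4) 0]; 'X_[mexp 0 0 1 (p - 3) 0]; 'X_[mexp 0 0 0 (p - 1) 0];
      'X_[mexp 0 0 0 0 p]].
Proof.
have -> : 'X_[mexp 0 1 1 1 0] = 'X_(inord 3) * 'X_(inord 2) * 'X_(inord 1) :> P.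
  by rewrite mpolyX_mexp !expr0; ring.
have -> : 'X_[mexp 0 1 0 (p - 4) 0] = 'X_(inord 3) ^+ (p - 4) * 'X_(inord 1) :> P.
  by rewrite mpolyX_mexp !expr0 !mul1r mulr1 mulrC.
have -> : 'X_[mexp 0 0 1 (p - 3) 0] = 'X_(inord 3) ^+ (p - 3) * 'X_(inord 2) :> P.
  by rewrite mpolyX_mexp !expr0 !mul1r mulr1 mulrC.
by rewrite !mpolyX_mexp !expr0 !mul1r !mulr1.
Qed.

Lemma mcoeff_quadric m : quadric@_m = (mexp 0 0 2 0 0 == m)%:R
  - 2%:R * (mexp 0 1 0 1 0 == m)%:R - (mexp 0 1 1 0 0 == m)%:R.
Proof.
have -> : quadric = 'X_[mexp 0 0 2 0 0] - 2%:R *: 'X_[mexp 0 1 0 1 0] - 'X_[mexp 0 1 1 0 0].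
  by rewrite !mpolyX_mexp !expr0 scaler_nat -mulr_natl /quadric; ring.
by rewrite !mcoeffB mcoeffZ !mcoeffX.
Qed.

Lemma msupp_quadric m : m \in msupp quadric ->
  [\/ m = mexp 0 0 2 0 0, m = mexp 0 1 0 1 0 | m = mexp 0 1 1 0 0].
Proof.
rewrite mcoeff_msupp mcoeff_quadric.
case: (mexp 0 0 2 0 0 =P m) => [<-|_]; first by constructor 1.
case: (mexp 0 1 0 1 0 =P m) => [<-|_]; first by constructor 2.
case: (mexp 0 1 1 0 0 =P m) => [<-|_]; first by constructor 3.
by rewrite mulr0 !subr0 eqxx.
Qed.

Lemma grevlex_lt_X2 a b c d e b' c' d' e' :
  (a + b + c + d + e = a + b' + c' + d' + e')%N -> (b' < b)%N ->
  grevlex_lt (mexp a b c d e) (mexp a b' c' d' e').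
Proof.
move=> eq_deg lt_b; apply/grevlex_ltP; first by rewrite !mdeg_mexp.
exists (inord 1); rewrite !mexpE inordK //; split=> // j; rewrite !mexpE ltnS leqn0.
by move=> /eqP->.
Qed.

Lemma glead_quadric : glead quadric = mexp 0 0 2 0 0.
Proof.
apply: glead_unique => [|m /msupp_quadric[]-> ne].
- by rewrite mcoeff_msupp mcoeff_quadric !mexp_eq /= mulr0 !subr0 oner_eq0.
- by rewrite eqxx in ne.
- exact: grevlex_lt_X2.
exact: grevlex_lt_X2.
Qed.

Lemma glead_groebner_basis : map (@glead 5 F) groebner_basis = lead_exponents.
Proof. by rewrite groebner_basisE /= !gleadX glead_quadric. Qed.

Lemma hilbert_ideal_groebner_basis g : g \in groebner_basis -> hilbert_ideal g.
Proof.
have piM (f h : P) : pi (f * h) = pi f * pi h by exact: rmorphM.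
have piB (f h : P) : pi (f - h) = pi f - pi h by exact: rmorphB.
have piX (f : P) k : pi (f ^+ k) = pi f ^+ k by exact: rmorphXn.
have pi_nat k : pi k%:R = k%:R by exact: rmorph_nat.
move=> hg; apply/to_coinvariants_eq0; move: hg; rewrite !inE /quadric.
case/or4P=> [/eqP->|/eqP->|/eqP->|/or4P[/eqP->|/eqP->|/eqP->|/orP[/eqP->|/eqP->]]].
- exact: (pi_X1 p_gt5 charF).
- by rewrite piX (pi_X2_sqr p_gt5 charF).
- by rewrite !piB piX !piM pi_nat (pi_X3_sqr p_gt5 charF) addrAC addrK subrr.
- by rewrite !piM (pi_X432 p_gt5 charF).
- by rewrite piM piX (pi_X4X2 p_gt5 charF).
- by rewrite piM piX (pi_X4X3 p_gt5 charF).
- by rewrite piX (pi_X4_pow p_gt5 charF).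
- by rewrite piX (pi_X5_pow p_gt5 charF).
Qed.

Definition standard_exponent m := ~~ has (fun l => (l <= m)%MM) lead_exponents.

Lemma standard_monomialE : standard_monomial groebner_basis =1 standard_exponent.
Proof.
move=> m; rewrite /standard_monomial /standard_exponent -glead_groebner_basis.
by rewrite has_map.
Qed.

Lemma standard_exponentE a b c d e : standard_exponent (mexp a b c d e)
  = [&& a == 0, e < p & [|| [&& b == 0, c == 0 & d < p - 1],
      [&& b == 0, c == 1 & d < p - 3], [&& b == 1, c == 0 & d < p - 4]
      | [&& b == 1, c == 1 & d == 0]]]%N.
Proof.
rewrite /standard_exponent /= !mexp_le !orbF.
case: a b c => [|a] [|[|b]] [|[|c]] //=; rewrite ?andbF ?orbT ?andbT ?orbF //=; clear -p_gt5; lia.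
Qed.

(* The second monomial in [functional_X2X4] and in [functional_X2X3] is larger than
   the first, so its coefficient vanishes when the first is the leading one. *)
Lemma hilbert_ideal_lead (f : P) : hilbert_ideal f -> f != 0 -> ~~ standard_exponent (glead f).
Proof.
move=> If f_neq0; have := glead_msupp f_neq0; rewrite mcoeff_msupp.
have lead_max m : grevlex_lt (glead f) m -> f@_m = 0.
  by move=> lt_m; apply/memN_msupp_eq0/negP => /glead_max; rewrite lt_m.
move: lead_max; elim/mexpP: (glead f) => a b c d e lead_max lead_neq0.
rewrite standard_exponentE; apply/negP => /and3P[/eqP a0 lt_ep]; subst a.
have ann_f : annihilated p f by apply: annihilated_hilbert_ideal.
have [fA fB fC fD] := ann_f e lt_ep.
case/or4P=> /and3P[/eqP b0 /eqP c0 hd]; subst b c; case/eqP: lead_neq0.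
- by apply: fA; lia.
- by apply: fB; lia.
- have := fC d; rewrite /functional_X2X4; case: d hd lead_max => [|d] hd lead_max.
    by rewrite addr0; apply; lia.
  rewrite (lead_max (mexp 0 0 2 d e)) ?mulr0 ?addr0; first by apply; lia.
  by apply: grevlex_lt_X2 => //; lia.
move/eqP: hd => d0; subst d; move: fD; rewrite /functional_X2X3.
by rewrite (lead_max (mexp 0 0 2 0 e)) ?addr0 //; apply: grevlex_lt_X2.
Qed.

Lemma groebner_basis_reduced : is_reduced_groebner (@hilbert_ideal F 5) groebner_basis.
Proof.
have coef_lead g : g \in groebner_basis -> g@_(glead g) = 1.
  have quad : quadric@_(glead quadric) = 1.
    by rewrite glead_quadric mcoeff_quadric !mexp_eq /= mulr0 !subr0.
  rewrite groebner_basisE !inE.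
  by case/or4P=> [/eqP->|/eqP->|/eqP->|/or4P[/eqP->|/eqP->|/eqP->|/orP[/eqP->|/eqP->]]] //;
    rewrite gleadX mcoeffX eqxx.
split=> //; first split=> [g hg|f If f_neq0].
- split; last exact: hilbert_ideal_groebner_basis.
  by apply: contra_eq_neq (coef_lead _ hg) => ->; rewrite mcoeff0 eq_sym oner_eq0.
- have := hilbert_ideal_lead If f_neq0.
  rewrite -standard_monomialE negbK => /hasP[g hg le_g]; by exists g.
move=> g h m hg hh ne mg; apply: contra ne => le_hm.
have lead_mem k : k \in groebner_basis -> glead k \in lead_exponents.
  by rewrite -glead_groebner_basis; apply: map_f.
(* Only the quadric is not a monomial, and its two lower terms are standard, so no leading monomial
   divides them. *)
have lead_m : glead g = m.
  move: hg mg; rewrite {1}groebner_basisE !inE.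
  case/or4P=> [/eqP->|/eqP->|/eqP->|/or4P[/eqP->|/eqP->|/eqP->|/orP[/eqP->|/eqP->]]];
    rewrite ?gleadX ?msuppX ?mem_seq1 ?glead_quadric; try by move/eqP.
  have no_lead m' : ~~ has (fun l => (l <= m')%MM) lead_exponents -> ~ (glead h <= m')%MM.
    by move=> /hasPn no_l le; have := no_l _ (lead_mem _ hh); rewrite le.
  by case/msupp_quadric=> // Dm; case: (no_lead _ _ le_hm);
    rewrite Dm -/(standard_exponent _) standard_exponentE /=; lia.
have anti l l' : l \in lead_exponents -> l' \in lead_exponents -> (l <= l')%MM -> l = l'.
  move=> hl hl' le_l; apply/eqP; apply: contraTT le_l => ne_l.
  have : all (fun l => all (fun l' => (l <= l')%MM ==> (l == l')) lead_exponents) lead_exponents.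
    by rewrite /= !mexp_le !mexp_eq; do !(apply/andP; split => //); clear -p_gt5; lia.
  by move=> /allP/(_ _ hl)/allP/(_ _ hl'); rewrite (negPf ne_l) implybF.
have uniq_lead : uniq lead_exponents.
  by rewrite /= !inE !mexp_eq; do !(apply/andP; split => //); clear -p_gt5; lia.
have nth_lead k : k \in groebner_basis ->
    nth 0%MM lead_exponents (index k groebner_basis) = glead k.
  by move=> hk; rewrite -glead_groebner_basis (nth_map 0) ?index_mem // nth_index.
have index_lt k : k \in groebner_basis ->
    (index k groebner_basis < size lead_exponents)%N.
  by rewrite -index_mem -glead_groebner_basis size_map.
(* The leading monomials are pairwise incomparable and distinct; h and g, having the same one,
   occupy the same position in the list. *)
rewrite -(nth_index 0 hh) -(nth_index 0 hg); apply/eqP; congr nth.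
apply/eqP; rewrite -(nth_uniq 0%MM _ _ uniq_lead) ?index_lt // !nth_lead //.
by apply/eqP/anti; rewrite ?lead_mem // lead_m.
Qed.

Lemma standard_maximal m : standard_exponent m = has (fun t => (m <= t)%MM)
  [:: mexp 0 0 0 (p - 2) (p - 1); mexp 0 0 1 (p - 4) (p - 1);
      mexp 0 1 0 (p - 5) (p - 1); mexp 0 1 1 0 (p - 1)].
Proof.
elim/mexpP: m => a b c d e; rewrite standard_exponentE /= !mexp_le.
case: a b c => [|a] [|[|b]] [|[|c]] //=; rewrite ?andbF ?orbT ?andbT ?orbF //=;
  clear -p_gt5; lia.
Qed.

End GroebnerBasis.

(** * The monomial basis and the Hilbert series *)

Section Basis.
Variables (p : nat) (F : fieldType).
Hypotheses (p_gt5 : (5 < p)%N) (charF : p \in [pchar F]).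
Local Notation P := {mpoly F[5]}.
Local Notation pi := (@to_coinvariants F 5).

Lemma to_coinvariantsZ c (f : P) : pi (c *: f) = c *: pi f.
Proof. by rewrite -mul_mpolyC; exact: rmorphM. Qed.

(** A nontrivial relation would be a nonzero element of the Hilbert ideal whose leading monomial is
    one of its standard terms. *)
Lemma standard_free (s : seq 'X_{1..5}) (c : 'X_{1..5} -> F) :
  uniq s -> all (standard_exponent p) s -> \sum_(m <- s) c m *: pi 'X_[m] = 0 ->
  forall m, m \in s -> c m = 0.
Proof.
move=> uniq_s std_s sum0; pose f : P := \sum_(m <- s) c m *: 'X_[m].
have coef_f m : f@_m = if m \in s then c m else 0.
  rewrite raddf_sum /=; case: ifP => [ms|/negP nms].
    rewrite (bigD1_seq m) //= mcoeffZ mcoeffX eqxx mulr1 big1 ?addr0 // => k /negPf ne.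
    by rewrite mcoeffZ mcoeffX ne mulr0.
  rewrite big_seq big1 // => k ks; rewrite mcoeffZ mcoeffX.
  by case: eqP => [Dk|_]; [rewrite Dk in ks | rewrite mulr0].
suff f0 : f = 0 by move=> m ms; have := coef_f m; rewrite ms f0 mcoeff0.
apply/eqP; apply: contraT => f_neq0.
have If : hilbert_ideal f.
  apply/to_coinvariants_eq0; rewrite -sum0 /f.
  have pi_sum : pi (\sum_(m <- s) c m *: 'X_[m]) = \sum_(m <- s) pi (c m *: 'X_[m]).
    exact: raddf_sum.
  by rewrite pi_sum; apply: eq_bigr => m _; exact: to_coinvariantsZ.
have := hilbert_ideal_lead p_gt5 charF If f_neq0.
have := glead_msupp f_neq0; rewrite mcoeff_msupp coef_f.
by case: ifP => [/(allP std_s) -> //|_]; rewrite eqxx.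
Qed.

(** Exponents of X_2, X_3 and X_4. The exponent of X_5 varies independently, which produces the
    factor 1 + t + ... + t^(p-1) of the Hilbert series. *)
Definition standard_shapes : seq (nat * nat * nat) :=
  [seq (0, 0, d)%N | d <- iota 0 (p - 1)] ++ [seq (0, 1, d)%N | d <- iota 0 (p - 3)]
  ++ [seq (1, 0, d)%N | d <- iota 0 (p - 4)] ++ [:: (1, 1, 0)%N].

Definition standard_list : seq 'X_{1..5} :=
  [seq mexp 0 t.1.1 t.1.2 t.2 e | t <- standard_shapes, e <- iota 0 p].

Lemma mem_shape (b c k b' c' d : nat) :
  ((b', c', d) \in [seq (b, c, d') | d' <- iota 0 k]) = [&& b' == b, c' == c & d < k]%N.
Proof.
apply/mapP/and3P => [[d']|[/eqP-> /eqP-> hd]].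
  by rewrite mem_iota => hd' [-> -> ->].
by exists d; rewrite // mem_iota.
Qed.

Lemma mem_standard_shapes b c d : ((b, c, d) \in standard_shapes)
  = [|| [&& b == 0, c == 0 & d < p - 1], [&& b == 0, c == 1 & d < p - 3],
        [&& b == 1, c == 0 & d < p - 4] | [&& b == 1, c == 1 & d == 0]]%N.
Proof. by rewrite !mem_cat !mem_shape mem_seq1 !xpair_eqE -!andbA. Qed.

Lemma mem_standard_list m : (m \in standard_list) = standard_exponent p m.
Proof.
elim/mexpP: m => a b c d e; rewrite standard_exponentE // -mem_standard_shapes.
apply/allpairsP/and3P => [[[[[b' c'] d'] e'] /= [ht he /mexp_inj[-> -> -> -> ->]]]|].
  by rewrite eqxx ht; move: he; rewrite mem_iota.
by case=> /eqP-> he ht; exists (b, c, d, e); rewrite /= mem_iota.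
Qed.

Lemma uniq_standard_list : uniq standard_list.
Proof.
apply: allpairs_uniq; last by
  case=> [[[b c] d] e] [[[b' c'] d'] e'] _ _ /= /mexp_inj[_ -> -> -> ->].
  have inj_shape (b c : nat) : injective (fun d : nat => (b, c, d)) by move=> d d' [].
  rewrite /standard_shapes !cat_uniq !(map_inj_uniq (inj_shape _ _)) !iota_uniq.
  by repeat (apply/andP; split => //); apply/hasPn => -[[b c] d];
    rewrite ?mem_cat !mem_shape ?mem_seq1 ?xpair_eqE; clear; lia.
exact: iota_uniq.
Qed.

Definition span_of (S : seq 'X_{1..5}) (x : coinvariants F 5) : Prop :=
  exists c : 'X_{1..5} -> F, x = \sum_(m <- S) c m *: pi 'X_[m].

Lemma span_of_linear S k x y : span_of S x -> span_of S y -> span_of S (k *: x + y).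
Proof.
move=> [c ->] [d ->]; exists (fun m => k * c m + d m).
rewrite scaler_sumr -big_split; apply: eq_bigr => m _ /=.
by rewrite scalerDl scalerA.
Qed.

Lemma span_of0 S : span_of S 0.
Proof. by exists (fun=> 0); rewrite big1 // => m _; rewrite scale0r. Qed.

Lemma span_ofD S x y : span_of S x -> span_of S y -> span_of S (x + y).
Proof. by rewrite -[x in x + y]scale1r; apply: span_of_linear. Qed.

Lemma span_of_mem S m : uniq S -> m \in S -> span_of S (pi 'X_[m]).
Proof.
move=> uniq_S mS; exists (fun m' => (m' == m)%:R).
rewrite (bigD1_seq m) //= eqxx scale1r big1 ?addr0 // => k /negPf->.
by rewrite scale0r.
Qed.

Definition standard_degree d := [seq m <- standard_list | mdeg m == d].

Lemma pi_mexp a b c d e : pi 'X_[mexp a b c d e] =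
  pi 'X_(inord 0) ^+ a * (pi 'X_(inord 1) ^+ b * (pi 'X_(inord 2) ^+ c
    * (pi 'X_(inord 3) ^+ d * pi 'X_(inord 4) ^+ e))).
Proof.
have piM (f h : P) : pi (f * h) = pi f * pi h by exact: rmorphM.
have piX (f : P) k : pi (f ^+ k) = pi f ^+ k by exact: rmorphXn.
by rewrite mpolyX_mexp !piM !piX.
Qed.

Lemma expr_eq0_ge (R : comNzRingType) (x y : R) k l :
  x ^+ k * y = 0 -> (k <= l)%N -> x ^+ l * y = 0.
Proof. by move=> xk /subnK<-; rewrite exprD -mulrA xk mulr0. Qed.

(** The coefficient 2 is written as a repeated summand so that each term is the image of a plain
    monomial. *)
Lemma reduce_sqr (R : comNzRingType) (x1 x2 x3 x4 x5 : R) a b c d e :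
  x3 ^+ 2 = 2%:R * x4 * x2 + x3 * x2 ->
  x1 ^+ a * (x2 ^+ b * (x3 ^+ c.+2 * (x4 ^+ d * x5 ^+ e))) =
    x1 ^+ a * (x2 ^+ b.+1 * (x3 ^+ c * (x4 ^+ d.+1 * x5 ^+ e)))
    + x1 ^+ a * (x2 ^+ b.+1 * (x3 ^+ c * (x4 ^+ d.+1 * x5 ^+ e)))
    + x1 ^+ a * (x2 ^+ b.+1 * (x3 ^+ c.+1 * (x4 ^+ d * x5 ^+ e))).
Proof.
move=> x33; have -> : x3 ^+ c.+2 = x3 ^+ c * x3 ^+ 2 by rewrite -exprD addn2.
by rewrite x33 !exprS; ring.
Qed.

(** The relation for X_3^2 preserves the degree and lowers the exponent of X_3, on which the
    induction runs. Once that exponent is at most 1, a nonstandard monomial is zero by one of the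
    other relations. *)
Lemma span_of_mexp a b c d e : span_of (standard_degree (a + b + c + d + e)%N)
  (pi 'X_[mexp a b c d e]).
Proof.
elim/ltn_ind: c b d => c IHc b d.
have [std|nstd] := boolP (standard_exponent p (mexp a b c d e)).
  apply: span_of_mem; first exact/filter_uniq/uniq_standard_list.
  by rewrite mem_filter mdeg_mexp eqxx mem_standard_list.
have zero : pi 'X_[mexp a b c d e] = 0 ->
    span_of (standard_degree (a + b + c + d + e)%N) (pi 'X_[mexp a b c d e]).
  by move=> ->; apply: span_of0.
have [a0|a_gt0] := posnP a; last first.
  by apply: zero; rewrite pi_mexp (pi_X1 p_gt5 charF) expr0n gtn_eqF // mul0r.
have [lt_b|ge_b] := ltnP b 2; last first.
  apply: zero; rewrite pi_mexp; suff -> : pi 'X_(inord 1) ^+ b = 0.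
    by rewrite mul0r mulr0.
  by rewrite -(subnK ge_b) exprD (pi_X2_sqr p_gt5 charF) mulr0.
have [lt_e|ge_e] := ltnP e p; last first.
  apply: zero; rewrite pi_mexp; suff -> : pi 'X_(inord 4) ^+ e = 0 by rewrite !mulr0.
  by rewrite -(subnK ge_e) exprD (pi_X5_pow p_gt5 charF) mulr0.
have [lt_c|] := ltnP c 2; last first.
  case: c IHc {nstd zero} => [|[|c]] // IHc _.
  have -> : pi 'X_[mexp a b c.+2 d e]
    = pi 'X_[mexp a b.+1 c d.+1 e] + pi 'X_[mexp a b.+1 c d.+1 e]
      + pi 'X_[mexp a b.+1 c.+1 d e].
    by rewrite !pi_mexp; apply: reduce_sqr; exact: (pi_X3_sqr p_gt5 charF).
  have -> : (a + b + c.+2 + d + e = a + b.+1 + c + d.+1 + e)%N by lia.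
  apply: span_ofD; first by apply: span_ofD; apply: IHc; lia.
  have -> : (a + b.+1 + c + d.+1 + e = a + b.+1 + c.+1 + d + e)%N by lia.
  by apply: IHc; lia.
have X42 := expr_eq0_ge (pi_X4X2 p_gt5 charF).
have X43 := expr_eq0_ge (pi_X4X3 p_gt5 charF).
have X4 := expr_eq0_ge (y := 1) (etrans (mulr1 _) (pi_X4_pow p_gt5 charF)).
apply: zero; move: nstd; rewrite a0 standard_exponentE // lt_e /= pi_mexp expr0 mul1r.
case: b lt_b {IHc} => [|[|//]] _; case: c lt_c => [|[|//]] _;
  rewrite ?(orbF, expr0, expr1, mul1r) /= -?leqNgt.
- by move/X4; rewrite mulr1 => ->; rewrite mul0r.
- by move/X43 => X43d; rewrite mulrA [_ * _ ^+ d]mulrC X43d mul0r.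
- by move/X42 => X42d; rewrite mulrA [_ * _ ^+ d]mulrC X42d mul0r.
case: d => [|d] // _; have X432 := pi_X432 p_gt5 charF.
transitivity (pi 'X_(inord 3) * pi 'X_(inord 2) * pi 'X_(inord 1)
    * (pi 'X_(inord 3) ^+ d * pi 'X_(inord 4) ^+ e)); last by rewrite X432 mul0r.
by rewrite exprS; ring.
Qed.

Lemma span_of_homog d (f : P) : f \is d.-homog -> span_of (standard_degree d) (pi f).
Proof.
move=> homog_f; rewrite [f]mpolyE.
have -> : pi (\sum_(m <- msupp f) f@_m *: 'X_[m]) = \sum_(m <- msupp f) pi (f@_m *: 'X_[m]).
  exact: raddf_sum.
rewrite big_seq; elim/big_ind: _ => [||m mf]; [exact: span_of0 | exact: span_ofD |].
rewrite -(dhomog_mf homog_f mf) to_coinvariantsZ -[_ *: _]addr0.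
apply: span_of_linear (span_of0 _); elim/mexpP: (m) => a b c k e.
by rewrite /= mdeg_mexp; apply: span_of_mexp.
Qed.

Lemma span_of_all (f : P) : span_of standard_list (pi f).
Proof.
rewrite [f]mpolyE.
have -> : pi (\sum_(m <- msupp f) f@_m *: 'X_[m]) = \sum_(m <- msupp f) pi (f@_m *: 'X_[m]).
  exact: raddf_sum.
elim/big_ind: _ => [||m _]; [exact: span_of0 | exact: span_ofD |].
rewrite to_coinvariantsZ -[_ *: _]addr0; apply: span_of_linear (span_of0 _).
have [c ->] := span_of_homog (d := mdeg m) (f := 'X_[m]) ltac:(by rewrite dhomogX).
(* The combination over one degree is extended by zero to all standard monomials. *)
exists (fun m' => if mdeg m' == mdeg m then c m' else 0).
rewrite big_filter big_mkcond; apply: eq_bigr => m' _.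
by case: ifP; rewrite ?scale0r.
Qed.

Lemma standard_monomial_basis : is_monomial_basis F (standard_exponent p).
Proof.
split=> // [s c uniq_s std_s sum0|x _]; first exact: standard_free.
have [f ->] : exists f, x = pi f.
  by exists (generic_quotient.repr x); rewrite /to_coinvariants generic_quotient.reprK.
have [c ->] := span_of_all f; exists standard_list, c; split=> //.
by apply/allP => m; rewrite mem_standard_list.
Qed.

Lemma has_dim_standard_degree d :
  has_dim (@coinvariants_homog F 5 d) (size (standard_degree d)).
Proof.
set S := standard_degree d.
have uniq_S : uniq S by exact/filter_uniq/uniq_standard_list.
have S_P m : m \in S -> standard_exponent p m /\ mdeg m = d.
  by rewrite mem_filter mem_standard_list => /andP[/eqP].
exists (fun i => pi 'X_[nth 0%MM S i]); split.
- move=> i _; exists 'X_[nth 0%MM S i] => //.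
  by rewrite dhomogX /=; apply/eqP; have [] := S_P _ (mem_nth 0%MM (ltn_ord i)).
- move=> s c uniq_s _ sum0 i i_s.
  pose e (j : 'I_(size S)) := nth 0%MM S j.
  have inj_e : injective e.
    by move=> j k /eqP; rewrite /e nth_uniq // => /eqP/val_inj.
  (* The coefficients, indexed by positions in S, are carried over to monomials so that freeness of
     the standard monomials applies. *)
  pose c' m := if insub (index m S) is Some j then c j else 0.
  have c'E j : c' (e j) = c j by rewrite /c' /e index_uniq // valK.
  rewrite -c'E; apply: (@standard_free (map e s)); last exact: map_f.
  + by rewrite map_inj_uniq.
  + by apply/allP => m /mapP[j _ ->]; have [] := S_P _ (mem_nth 0%MM (ltn_ord j)).
  by rewrite big_map -[RHS]sum0; apply: eq_bigr => j _; rewrite c'E.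
move=> w [f homog_f ->]; have [c ->] := span_of_homog homog_f.
exists (index_enum 'I_(size S)), (fun i : 'I_(size S) => c (nth 0%MM S i)); split.
  by apply/allP.
by rewrite -/S (big_nth 0%MM) big_mkord.
Qed.

Lemma coef_sum_Xn (S : seq 'X_{1..5}) d :
  (\sum_(m <- S) 'X^(mdeg m) : {poly nat})`_d = size [seq m <- S | mdeg m == d].
Proof.
rewrite coef_sum size_filter -sum1_count [RHS]big_mkcond; apply: eq_bigr => m _.
by rewrite coefXn eq_sym; case: eqP.
Qed.

Lemma sum_standard_list : \sum_(m <- standard_list) 'X^(mdeg m) =
  (\sum_(t <- standard_shapes) 'X^(t.1.1 + t.1.2 + t.2)) * (\sum_(0 <= i < p) 'X^i)
  :> {poly nat}.
Proof.
rewrite big_allpairs_dep big_distrl; apply: eq_bigr => t _.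
rewrite big_distrr /index_iota subn0; apply: eq_bigr => e _.
by rewrite mdeg_mexp add0n exprD.
Qed.

End Basis.

(** * The Hilbert series *)

Section HilbertSeries.
Variables (p : nat) (F : fieldType).
Hypotheses (p_gt5 : (5 < p)%N) (charF : p \in [pchar F]).

(** Three progressions with exponents 0 to p - 2, 1 to p - 3 and 1 to p - 4 overlap, and X_2 X_3
    contributes one more t^2. This explains the coefficients 1, 3, 4, 3, ..., 3, 2, 1. *)
Lemma sum_standard_shapes (H := \sum_(3 <= i < (p - 4).+1) 'X^i : {poly nat}) :
  \sum_(t <- standard_shapes p) 'X^(t.1.1 + t.1.2 + t.2)
  = 1 + 3%:R * 'X + 4%:R * 'X^2 + 3%:R * H + 2%:R * 'X^(p - 3) + 'X^(p - 2)
  :> {poly nat}.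
Proof.
have p_neq6 : p != 6 by apply: contraTneq (pcharf_prime charF) => ->.
(* Being prime and greater than 5, p is at least 7. Then p - 4 is at least 3, so the middle range is
   nonempty and no subtraction is truncated. *)
have [q Dp] : exists q, p = (q + 7)%N by exists (p - 7)%N; lia.
have iotaE k (f : nat -> {poly nat}) : \sum_(d <- iota 0 k) f d = \sum_(0 <= d < k) f d.
  by rewrite /index_iota subn0.
have tail k : \sum_(0 <= d < k) 'X^(d.+1) = \sum_(1 <= d < k.+1) 'X^d :> {poly nat}.
  by rewrite [RHS]big_add1.
rewrite !big_cat !big_map big_seq1 /= (iotaE (p - 1)%N) (iotaE (p - 3)%N) (iotaE (p - 4)%N).
under [X in _ + (X + _)]eq_bigr => d _ do rewrite add0n add1n.
under [X in _ + (_ + (X + _))]eq_bigr => d _ do rewrite addn0 add1n.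
rewrite !tail /H {H} Dp.
have -> : (q + 7 - 1 = q.+4.+2)%N by lia.
have -> : (q + 7 - 2 = q.+4.+1)%N by lia.
have -> : (q + 7 - 3 = q.+4)%N by lia.
have -> : (q + 7 - 4 = q.+3)%N by lia.
rewrite (big_nat_recr q.+4.+1) // (big_nat_recr q.+4) //= (big_nat_recr q.+4) //=.
have split3 k : (k <= 3)%N -> \sum_(k <= i < q.+4) 'X^i
    = \sum_(k <= i < 3) 'X^i + \sum_(3 <= i < q.+4) 'X^i :> {poly nat}.
  by move=> hk; rewrite (big_cat_nat hk).
under eq_bigr => i _ do rewrite !add0n.
rewrite !add0n (split3 0%N) // (split3 1%N) //; move: (\sum_(3 <= i < _) _) => h.
rewrite /index_iota /= !big_cons !big_nil; move: ('X^(q.+4)) ('X^(q.+4.+1)) => t1 t2.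
by ring.
Qed.

Lemma coinvariants_series (H := \sum_(3 <= i < (p - 4).+1) 'X^i : {poly nat}) :
  coinvariants_hilbert_series F 5
    ((1 + 3%:R * 'X + 4%:R * 'X^2 + 3%:R * H + 2%:R * 'X^(p - 3) + 'X^(p - 2))
     * (\sum_(0 <= i < p) 'X^i)).
Proof.
move=> d; rewrite -sum_standard_shapes -sum_standard_list coef_sum_Xn.
exact: has_dim_standard_degree.
Qed.

End HilbertSeries.

Theorem theorem5p1 (p : nat) (F : fieldType) (p_prime : prime p)
    (p_gt5 : (5 < p)%N) (charF : p \in [pchar F]) :
  let X1 : {mpoly F[5]} := 'X_(inord 0) in
  let X2 : {mpoly F[5]} := 'X_(inord 1) in
  let X3 : {mpoly F[5]} := 'X_(inord 2) in
  let X4 : {mpoly F[5]} := 'X_(inord 3) in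
  let X5 : {mpoly F[5]} := 'X_(inord 4) in
  let G : seq {mpoly F[5]} :=
    [:: X1;
        X2 ^+ 2;
        X3 ^+ 2 - 2%:R * X4 * X2 - X3 * X2;
        X4 * X3 * X2;
        X4 ^+ (p - 4) * X2;
        X4 ^+ (p - 3) * X3;
        X4 ^+ (p - 1);
        X5 ^+ p] in
  let u2 : 'X_{1..5} := U_(inord 1)%MM in
  let u3 : 'X_{1..5} := U_(inord 2)%MM in
  let u4 : 'X_{1..5} := U_(inord 3)%MM in
  let u5 : 'X_{1..5} := U_(inord 4)%MM in
  let maximal_monomials : seq 'X_{1..5} :=
    [:: (u4 *+ (p - 2) + u5 *+ (p - 1))%MM;
        (u3 + u4 *+ (p - 4) + u5 *+ (p - 1))%MM;
        (u2 + u4 *+ (p - 5) + u5 *+ (p - 1))%MM;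
        (u2 + u3 + u5 *+ (p - 1))%MM] in
  let H : {poly nat} :=
    (1 + 3%:R * 'X + 4%:R * 'X^2 + 3%:R * (\sum_(3 <= i < (p - 4).+1) 'X^i)
       + 2%:R * 'X^(p - 3) + 'X^(p - 2)) * (\sum_(0 <= i < p) 'X^i) in
  [/\ is_reduced_groebner (@hilbert_ideal F 5) G,
      is_monomial_basis F (standard_monomial G),
      forall m : 'X_{1..5},
        standard_monomial G m = has (fun t => (m <= t)%MM) maximal_monomials
    & coinvariants_hilbert_series F 5 H].
Proof.
move=> X1 X2 X3 X4 X5 G u2 u3 u4 u5 maximal_monomials H.
(* [is_monomial_basis] depends on the predicate itself, so pointwise equality is turned into
   equality of functions. *)
have std_eq : standard_monomial G = standard_exponent p.
  by apply: boolp.funext; apply: standard_monomialE.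
split.
- exact: (groebner_basis_reduced p_gt5 charF).
- by rewrite std_eq; apply: standard_monomial_basis.
- move=> m; rewrite std_eq standard_maximal // /maximal_monomials /u2 /u3 /u4 /u5.
  rewrite !mexp_U // !mexpMn !mexpD.
  by rewrite !(mul0n, mul1n, addn0, add0n).
exact: coinvariants_series.
Qed.
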